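(* Let $d \geq 2$ and $\varepsilon > 0$. Then \[ \lim_{X \to \infty} \frac{1}{\# \mathscr{P}_d(X)} \cdot \# \left\{ \psi_{\mathbf{a}} \in \mathscr{P}_d(X) : \left| \lambda_1(\psi_{\mathbf{a}}) - \frac{\log \mathscr{H}(\psi_{\mathbf{a}})}{d(d-1)} \right| \leq \varepsilon \log \mathscr{H}(\psi_{\mathbf{a}}) \right\} = 1. \]
   Context: Let $d \geq 2$. Let $\mathbb{Z}^d_{\mathrm{prim}}$ be the set of $(x_1,\dots,x_d) \in \mathbb{Z}^d$ with $\gcd(x_1,\dots,x_d)=1$. Let $\mathscr{P}_d$ be the set of polynomials $\psi_{\mathbf{a}} \in \mathbb{Q}[z]$ indexed by $\mathbf{a} = (a_d, a_{d-2}, \dots, a_1, a_0) \in \mathbb{Z}^d_{\mathrm{prim}}$ with $a_d \neq 0$, $a_0 > 0$, where $\psi_{\mathbf{a}}(z) = \frac{a_d}{a_0} z^d + \frac{a_{d-2}}{a_0} z^{d-2} + \cdots + \frac{a_1}{a_0} z + 1$. Let $\mathscr{H}(\psi_{\mathbf{a}}) = \max\{|a_d|, |a_{d-2}|, \dots, |a_1|, a_0\}$ and $\mathscr{P}_d(X) = \{\psi_{\mathbf{a}} \in \mathscr{P}_d : \mathscr{H}(\psi_{\mathbf{a}}) \leq X\}$. Let $h$ be the logarithmic Weil height on $\mathbb{Q}$, $h(x/y) = \log \max\{|x|,|y|\}$ for coprime $x,y$. The canonical height is $\hat{h}_{\psi_{\mathbf{a}}}(z) = \lim_{n \to \infty}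 d^{-n} h(\psi_{\mathbf{a}}^n(z))$, where $\psi^n$ is the $n$-th iterate. $\mathrm{Prep}_{\mathbb{Q}}(\psi_{\mathbf{a}})$ is the set of $z \in \mathbb{Q}$ with $\psi_{\mathbf{a}}^{\ell+m}(z) = \psi_{\mathbf{a}}^\ell(z)$ for some $\ell \geq 0$, $m \geq 1$. Define $\lambda_1(\psi_{\mathbf{a}}) = \min\{\hat{h}_{\psi_{\mathbf{a}}}(z) : z \in \mathbb{Q} \setminus \mathrm{Prep}_{\mathbb{Q}}(\psi_{\mathbf{a}})\}$ (the minimum exists). *)

(* Defs.v *)
From HB Require Import structures.
From mathcomp Require Import all_boot all_order all_algebra.
From mathcomp Require Import finmap.
From mathcomp Require Import all_classical all_reals all_analysis.

Set Implicit Arguments.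
Unset Strict Implicit.
Unset Printing Implicit Defensive.

Import Order.TTheory GRing.Theory Num.Theory.
Import numFieldNormedType.Exports.

Local Open Scope classical_set_scope.
Local Open Scope ring_scope.

(* The vector (a_d, a_{d-2}, ..., a_1, a_0) is stored by increasing degree:
   a`_i is the coefficient a_i for i <= d - 2, and the last entry a`_(d.-1) is
   the leading coefficient a_d (there is no term of degree d - 1). *)

Definition primitive (d : nat) (a : d.-tuple int) : Prop :=
  \big[gcdn/0%N]_(x <- a) `|x|%N = 1%N.

Definition admissible (d : nat) (a : d.-tuple int) : Prop :=
  [/\ primitive a, a`_(d.-1) != 0 & 0 < a`_0].

Definition psi (d : nat) (a : d.-tuple int) : {poly rat} :=
  ((a`_(d.-1))%:~R / (a`_0)%:~R) *: 'X^d
  + \sum_(1 <= i < d.-1) ((a`_i)%:~R / (a`_0)%:~R) *: 'X^i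
  + 1.

Definition coef_height (d : nat) (a : d.-tuple int) : nat :=
  \max_(x <- a) `|x|%N.

Definition iterate (p : {poly rat}) (n : nat) (z : rat) : rat :=
  iter n (horner p) z.

Definition weil_height (R : realType) (z : rat) : R :=
  ln (maxn `|numq z|%N `|denq z|%N)%:R.

Definition canonical_height (R : realType) (d : nat) (p : {poly rat})
    (z : rat) : R :=
  lim ((fun n : nat => (d%:R ^- n * weil_height R (iterate p n z) : R)) @ \oo).

Definition Prep (p : {poly rat}) : set rat :=
  [set z | exists l m : nat,
     (1 <= m)%N /\ iterate p (l + m)%N z = iterate p l z].

(* The least element of A, when there is one (and 0 otherwise). *)
Definition set_min (R : realType) (A : set R) : R :=
  xget 0 (A `&` lbound A).

Definition lambda1 (R : realType) (d : nat) (p : {poly rat}) : R :=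
  set_min [set canonical_height R d p z | z in ~` Prep p].

(* The polynomials psi a of coefficient height at most X whose index a
   satisfies Q.  An admissible a is determined by psi a, so that Q may depend
   on coef_height a, the height of the polynomial psi a.  These sets are
   finite, so that fset_set below is not given its default value. *)
Definition Pd_such_that (R : realType) (d : nat) (X : R)
    (Q : d.-tuple int -> Prop) : set {poly rat} :=
  [set psi a | a in [set a : d.-tuple int |
     [/\ admissible a, (coef_height a)%:R <= X & Q a]]].

Definition Pd (R : realType) (d : nat) (X : R) : set {poly rat} :=
  [set psi a | a in [set a : d.-tuple int |
     admissible a /\ (coef_height a)%:R <= X]].

Definition cardinal (T : choiceType) (A : set T) : nat := #|` fset_set A|.

(* Main.v *)
(* Write z = x/y in lowest terms, so that psi(z) = F(x,y)/(a_0 y^d) with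
   F(x,y) = x Q(x,y) + a_0 y^d.

   Upper bound: psi(0) = 1 and h(psi(z)) <= d h(z) + log(d H) give
   hhat(0) <= log(d H)/(d(d-1)) for every a.

   Lower bound: for almost all a the integer a_0 is, up to a factor N^O(de), a
   squarefree q prime to a_d. If p | q divides the denominator of z or psi(z),
   the orbit escapes at p and p contributes at least log p/(d-1) to hhat(z); let
   A be the product of these p and B = q/A. For d >= 3 the other places
   contribute about h(z)/2, so that hhat(z) < (1/(d(d-1)) - O(de)) log N would
   force h(z) <= (log N)/3 and B > N^(2/3+de) H(z). But B divides both a_0 and
   x Q(x,y), so m = B/gcd(B,x) > N^(2/3+de) divides a_0 and Q(x,y). For given
   m, x, y this has probability O(1/m^2), since m | Q(x,y) fixes a_1 modulo m;
   summing over m and over the O(N^(2/3)) pairs (x,y), it happens for a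
   proportion O(N^(-de)) of the vectors a. The point z = 0 is treated through
   psi(0) = 1. For d = 2 every p | q contributes at least (log p)/2, because z,
   psi(z) and psi(psi(z)) cannot all be p-integral.

   The minimum defining lambda_1 is attained because hhat - h is bounded below
   for each fixed a. *)

Require Import Defs.
From HB Require Import structures.
From mathcomp Require Import all_boot all_order all_algebra.
From mathcomp Require Import all_classical all_reals all_analysis.
From mathcomp Require Import ring lra zify.

Set Implicit Arguments.
Unset Strict Implicit.
Unset Printing Implicit Defensive.

Import Order.TTheory GRing.Theory Num.Theory.
Import numFieldNormedType.Exports.

Local Open Scope classical_set_scope.
Local Open Scope ring_scope.

(** * Growth of the denominators along an orbit *)

(** The form [F] of the overview, obtained from psi(x/y) by clearing the denominator a_0 y^d;
    [psi_cof] is the form [Q]. *)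
Definition psi_num (d : nat) (a : d.-tuple int) (x y : int) : int :=
  a`_(d.-1) * x ^+ d + \sum_(1 <= i < d.-1) a`_i * x ^+ i * y ^+ (d - i)
  + a`_0 * y ^+ d.

Definition psi_cof (d : nat) (a : d.-tuple int) (x y : int) : int :=
  a`_(d.-1) * x ^+ d.-1
  + \sum_(1 <= i < d.-1) a`_i * x ^+ i.-1 * y ^+ (d - i).

(** The local height of [z] at a prime [p], in units of log p. *)
Definition denv (p : nat) (z : rat) : nat := logn p `|denq z|%N.

Lemma psi_numE (d : nat) (a : d.-tuple int) (x y : int) (d0 : (0 < d)%N) :
  psi_num a x y = x * psi_cof a x y + a`_0 * y ^+ d.
Proof.
rewrite /psi_num /psi_cof mulrDr; congr (_ + _ + _).
  by rewrite mulrCA -exprS prednK.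
rewrite mulr_sumr; apply: eq_big_nat => i /andP[i1 _].
have -> : x ^+ i = x * x ^+ i.-1 by rewrite -exprS prednK.
by ring.
Qed.

Lemma psi_horner (d : nat) (a : d.-tuple int) (z : rat) :
  (2 <= d)%N -> a`_0 != 0 ->
  (psi a).[z] * (a`_0 * denq z ^+ d)%:~R
  = (psi_num a (numq z) (denq z))%:~R.
Proof.
move=> d2 a0; have z0 : (denq z)%:~R != 0 :> rat by rewrite intr_eq0 denq_neq0.
have a0r : (a`_0)%:~R != 0 :> rat by rewrite intr_eq0.
rewrite /psi /psi_num !rmorphD /= !hornerD hornerZ hornerXn hornerC.
rewrite !mulrDl !rmorphM /= !rmorphXn /= mul1r numqE; congr (_ + _ + _).
  by rewrite exprMn; field.
rewrite horner_sum mulr_suml rmorph_sum /=; apply: eq_big_nat => i /andP[i1 i2].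
rewrite hornerZ hornerXn !rmorphM /= !rmorphXn /= numqE exprMn.
have -> : (denq z)%:~R ^+ d = (denq z)%:~R ^+ i * (denq z)%:~R ^+ (d - i) :> rat.
  by rewrite -exprD subnKC //; lia.
by field.
Qed.

(** Both sides are integers, so that valuations and divisibility can be compared, the numerator and
    denominator of psi(z) being coprime. *)
Lemma psi_step (d : nat) (a : d.-tuple int) (z : rat) :
  (2 <= d)%N -> a`_0 != 0 ->
  numq (psi a).[z] * (a`_0 * denq z ^+ d)
  = psi_num a (numq z) (denq z) * denq (psi a).[z].
Proof.
move=> d2 a0; apply: (@intr_inj rat).
by rewrite !rmorphM /= -psi_horner // (numqE (psi a).[z]) rmorphM /=; ring.
Qed.

Lemma absz_denq_gt0 (z : rat) : (0 < `|denq z|)%N.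
Proof. by rewrite absz_gt0 denq_neq0. Qed.

(** The square comes from the missing term of degree d - 1: every monomial of F except the leading
    one has degree at least 2 in y. *)
Lemma dvdz_mid (d : nat) (a : d.-tuple int) (x y : int) :
  (2 <= d)%N ->
  (y ^+ 2 %| psi_num a x y - a`_(d.-1) * x ^+ d)%Z.
Proof.
move=> d2; rewrite /psi_num addrAC [X in X + _]addrAC subrr add0r rpredD //.
  rewrite big_nat_cond; apply: rpred_sum => i /andP[/andP[i1 i2] _].
  by rewrite dvdz_mull // dvdz_exp2l //; lia.
by rewrite dvdz_mull // dvdz_exp2l.
Qed.

(** Modulo y^2 the form F is a_d x^d with x prime to [p], so 2 v_p(y) > v_p(a_d) forces v_p(F) <=
    v_p(a_d). It remains to compare valuations in [psi_step]. *)
Lemma denv_step (d : nat) (a : d.-tuple int) (z : rat) (p : nat) :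
  (2 <= d)%N -> a`_0 != 0 -> a`_(d.-1) != 0 -> prime p ->
  (logn p `|(a`_(d.-1))%R| < 2 * denv p z)%N ->
  (logn p `|(a`_0)%R| + d * denv p z
   <= denv p (psi a).[z] + logn p `|(a`_(d.-1))%R|)%N.
Proof.
move=> d2 a0 ad pp; set v := logn p _ => vk.
set F := psi_num a (numq z) (denq z).
have pF : ~~ (p ^ v.+1 %| `|F|)%N.
  have npF : ~~ (p ^ v.+1 %| `|(a`_(d.-1))%R|)%N.
    by rewrite pfactor_dvdn // ?absz_gt0 // -/v ltnn.
  apply: contra npF => pF.
  have h1 : ((p ^ v.+1)%N %| denq z ^+ 2)%Z.
    rewrite dvdzE /= abszX pfactor_dvdn ?expn_gt0 ?absz_denq_gt0 //.
    by rewrite lognX.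
  have := dvdz_trans h1 (dvdz_mid a (numq z) (denq z) d2).
  rewrite rpredBl; last by rewrite dvdzE.
  rewrite dvdzE abszM abszX /= Gauss_dvdl //.
  apply: coprimeXl; apply: coprimeXr.
  have pk : (p %| `|denq z|)%N.
    by rewrite -(expn1 p) pfactor_dvdn ?absz_denq_gt0 //; rewrite /denv in vk;
      lia.
  by apply: coprime_dvdl pk _; rewrite coprime_sym coprime_num_den.
have F0 : F != 0 by apply: contraNneq pF => ->; rewrite absz0 dvdn0.
have := psi_step z d2 a0; rewrite -/F => E.
have x10 : numq (psi a).[z] != 0.
  apply/eqP => x10; move/eqP: E; rewrite x10 mul0r eq_sym mulf_eq0.
  by rewrite (negbTE F0) denq_eq0.
have FV : (logn p `|F| <= v)%N.
  by rewrite leqNgt -pfactor_dvdn // absz_gt0.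
move/(congr1 (fun t : int => logn p `|t|)): E.
rewrite !abszM !lognM ?muln_gt0 ?absz_gt0 ?a0 ?expf_neq0 ?denq_neq0 //.
rewrite abszX lognX -/(denv p z) -/(denv p _).
lia.
Qed.

Lemma iterate_rec (f : {poly rat}) (n : nat) (z : rat) :
  iterate f n.+1 z = iterate f n f.[z].
Proof. by rewrite /iterate iterSr. Qed.

(** With k the valuation of the denominator, [denv_step] says that (d - 1) k + r - v is multiplied
    by at least d at each step. The condition v <= (d - 1) k makes k nondecreasing, so both
    conditions persist along the orbit. *)
Lemma denv_iterate (R : realType) (d : nat) (a : d.-tuple int) (z : rat)
    (p n : nat) :
  (2 <= d)%N -> a`_0 != 0 -> a`_(d.-1) != 0 -> prime p ->
  let r := logn p `|(a`_0)%R| in let v := logn p `|(a`_(d.-1))%R| in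
  (v < 2 * denv p z)%N -> (v <= d.-1 * denv p z)%N ->
  d%:R ^+ n * (d.-1%:R * (denv p z)%:R + r%:R - v%:R)
  <= d.-1%:R * (denv p (iterate (psi a) n z))%:R + r%:R - v%:R :> R.
Proof.
move=> d2 a0 ad pp r v; elim: n z => [|n IHn] z vk vdk.
  by rewrite expr0 mul1r.
have st := denv_step d2 a0 ad pp vk; rewrite -/r -/v in st.
have kk : (denv p z <= denv p (psi a).[z])%N.
  have : (d * denv p z = d.-1 * denv p z + denv p z)%N.
    by rewrite -{1}(prednK (ltnW d2)) mulSn addnC.
  by lia.
rewrite iterate_rec; apply: le_trans (IHn _ _ _); last 2 first.
- by lia.
- by apply: leq_trans vdk _; rewrite leq_mul2l kk orbT.
rewrite exprSr -mulrA ler_wpM2l ?exprn_ge0 //.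
have {}st : r%:R + d%:R * (denv p z)%:R
    <= (denv p (psi a).[z])%:R + v%:R :> R.
  by rewrite -natrM -!natrD ler_nat.
have dE : d%:R = d.-1%:R + 1 :> R by rewrite natr1 prednK // ltnW.
have d0 : 0 <= d.-1%:R :> R by [].
rewrite dE in st *; nra.
Qed.

(* [grows p z c]: the local canonical height of z at p is at least c log p. *)
Definition grows (R : realType) (d : nat) (f : {poly rat}) (p : nat) (z : rat)
    (c : R) : Prop :=
  exists D : R, forall n : nat,
    d%:R ^+ n * c - D <= (denv p (iterate f n z))%:R.

Lemma grows_le (R : realType) (d : nat) (f : {poly rat}) (p : nat) (z : rat)
    (c c' : R) :
  c' <= c -> grows d f p z c -> grows d f p z c'.
Proof.
move=> cc [D H]; exists D => n; apply: le_trans (H n).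
by rewrite lerD2r ler_wpM2l // exprn_ge0.
Qed.

Lemma grows_le0 (R : realType) (d : nat) (f : {poly rat}) (p : nat) (z : rat)
    (c : R) : c <= 0 -> grows d f p z c.
Proof.
move=> c0; exists 0 => n; rewrite subr0; apply: le_trans (ler0n _ _).
by rewrite mulr_ge0_le0 // exprn_ge0.
Qed.

Lemma grows_shift (R : realType) (d : nat) (f : {poly rat}) (p : nat) (z : rat)
    (c : R) : grows d f p f.[z] (d%:R * c) -> grows d f p z c.
Proof.
(* The hypothesis says nothing about the time n = 0; taking the constant at least [c] makes the
   bound trivial there. *)
move=> [D H]; exists (Num.max D c) => -[|n].
  rewrite expr0 mul1r; apply: le_trans (ler0n _ _).
  by rewrite subr_le0 le_max lexx orbT.
rewrite iterate_rec; apply: le_trans (H n).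
by rewrite exprSr mulrA lerD2l lerN2 le_max lexx.
Qed.

Lemma grows_denv (R : realType) (d : nat) (a : d.-tuple int) (z : rat)
    (p : nat) :
  (2 <= d)%N -> a`_0 != 0 -> a`_(d.-1) != 0 -> prime p ->
  let r := logn p `|(a`_0)%R| in let v := logn p `|(a`_(d.-1))%R| in
  (v < 2 * denv p z)%N -> (v <= d.-1 * denv p z)%N ->
  grows d (psi a) p z ((denv p z)%:R + (r%:R - v%:R) / d.-1%:R : R).
Proof.
move=> d2 a0 ad pp r v vk vdk.
have d0 : 0 < d.-1%:R :> R by rewrite ltr0n; lia.
exists ((r%:R - v%:R) / d.-1%:R) => n.
have := @denv_iterate R d a z p n d2 a0 ad pp vk vdk; rewrite -/r -/v => H.
rewrite -(ler_pM2l d0) mulrBr mulrCA mulrDr [_ * (_ / _)]mulrC.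
by rewrite divfK ?gt_eqF //; lra.
Qed.

(** * The archimedean place *)

Lemma ln_prod (R : realType) (I : Type) (s : seq I) (P : pred I) (F : I -> R) :
  (forall i, 0 < F i) ->
  ln (\prod_(i <- s | P i) F i) = \sum_(i <- s | P i) ln (F i).
Proof.
move=> F0; have [] // : 0 < \prod_(i <- s | P i) F i /\
  ln (\prod_(i <- s | P i) F i) = \sum_(i <- s | P i) ln (F i).
apply: (big_ind2 (fun x y => 0 < x /\ ln x = y)).
- by rewrite ln1.
- by move=> x1 y1 x2 y2 [x10 <-] [x20 <-]; rewrite mulr_gt0 // lnM.
- by [].
Qed.

Lemma ln_nat_ge0 (R : realType) (n : nat) : 0 <= ln (n%:R : R).
Proof.
case: n => [|n]; first by rewrite ln0.
by rewrite ln_ge0 // ler1n.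
Qed.

(** The bound [K] is left free so that several factorizations can be added over one range of
    primes. *)
Lemma ln_natE (R : realType) (n K : nat) : (0 < n)%N -> (n <= K)%N ->
  ln n%:R = \sum_(0 <= p < K.+1 | prime p) (logn p n)%:R * ln p%:R :> R.
Proof.
move=> n0 nK; rewrite -{1}(partnT n0) (widen_partn _ nK).
rewrite natr_prod ln_prod => [|p]; last by rewrite ltr0n pfactor_gt0.
rewrite [RHS]big_mkcond /=; apply: eq_big_nat => p _.
rewrite natrX; case: ifPn => pp;
  first by rewrite lnXn ?ltr0n ?prime_gt0 // mulr_natl.
by rewrite lognE (negbTE pp) /= expr0 ln1.
Qed.

(** Keeping finitely many primes lets their error terms add up to one constant; the primes left out
    contribute nonnegatively to the logarithm of the denominator. *)
Lemma grows_sum (R : realType) (d : nat) (f : {poly rat}) (z : rat)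
    (c : nat -> R) (K : nat) :
  (forall p, prime p -> grows d f p z (c p)) ->
  exists D : R, forall n,
    d%:R ^+ n * (\sum_(0 <= p < K | prime p) c p * ln p%:R) - D
    <= ln `|denq (iterate f n z)|%:R.
Proof.
move=> cg; suff [D H] : exists D : R, forall n,
    d%:R ^+ n * (\sum_(0 <= p < K | prime p) c p * ln p%:R) - D
    <= \sum_(0 <= p < K | prime p) (denv p (iterate f n z))%:R * ln p%:R.
  exists D => n; apply: le_trans (H n) _.
  set y := `|denq _|%N; have y0 : (0 < y)%N by apply: absz_denq_gt0.
  rewrite (ln_natE (K := maxn K y) _ y0 (leq_maxr _ _)).
  rewrite [leRHS](big_cat_nat (n := K)) //=;
    last by rewrite ltnW // ltnS leq_maxl.
  rewrite lerDl; apply: sumr_ge0 => p _; rewrite mulr_ge0 ?ler0n //;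
    exact: ln_nat_ge0.
elim: K => [|K [D H]].
  by exists 0 => n; rewrite !big_geq // mulr0 subr0.
have [pK|pK] := boolP (prime K); last first.
  exists D => n; rewrite big_mkcond [leRHS]big_mkcond !big_nat_recr //=.
  by rewrite (negbTE pK) !addr0 -!big_mkcond; exact: H.
have [D' H'] := cg K pK; exists (D + D' * ln K%:R) => n.
rewrite big_mkcond [leRHS]big_mkcond !big_nat_recr //= pK -!big_mkcond /=.
have := H n; have := ler_wpM2r (ln_nat_ge0 R K) (H' n).
set A := \sum_(0 <= p < K | _) _; set B := \sum_(0 <= p < K | _) _.
by move=> h1 h2; rewrite mulrDr mulrA; lra.
Qed.

Lemma weil_heightE (R : realType) (z : rat) :
  weil_height R z
  = ln `|denq z|%:R + ln (Num.max 1 `|ratr z : R|).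
Proof.
have y0 : 0 < `|denq z|%:R :> R by rewrite ltr0n absz_denq_gt0.
rewrite -lnM ?posrE // ?lt_max ?ltr01 //; congr ln.
rewrite maxr_pMr ?ltW // mulr1 /ratr normrM normfV -!intr_norm -!natr_absz.
by rewrite mulrC divfK ?gt_eqF // -natr_max maxEnat maxnC.
Qed.

Lemma psi_eval (d : nat) (a : d.-tuple int) (z : rat) :
  (2 <= d)%N -> a`_0 != 0 ->
  (psi a).[z] * (a`_0)%:~R
  = (a`_(d.-1))%:~R * z ^+ d + \sum_(0 <= i < d.-1) (a`_i)%:~R * z ^+ i.
Proof.
move=> d2 a0; have a0r : (a`_0)%:~R != 0 :> rat by rewrite intr_eq0.
rewrite /psi !hornerD hornerZ hornerXn hornerC !mulrDl mul1r.
rewrite [in RHS]big_ltn ?expr0 ?mulr1; last by lia.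
rewrite -addrA; congr (_ + _); first by field.
rewrite addrC; congr (_ + _); rewrite horner_sum mulr_suml.
by apply: eq_big_nat => i _; rewrite hornerZ hornerXn; field.
Qed.

(** Beyond 2dM the d - 1 lower terms together are at most half of the leading one, and a_0 costs at
    most a further factor M. *)
Lemma arch_step (R : realType) (d : nat) (a : d.-tuple int) (M : R)
    (z : rat) :
  (2 <= d)%N -> a`_0 != 0 -> a`_(d.-1) != 0 -> 1 <= M ->
  (forall i, (i < d)%N -> `|(a`_i)%:~R| <= M * `|(a`_(d.-1))%:~R|) ->
  2 * d%:R * M <= `|ratr z : R| ->
  `|ratr z| ^+ d <= 2 * M * `|ratr (psi a).[z] : R|.
Proof.
move=> d2 a0 ad M1 aM; set w := `|ratr z|;
  set A := `|(a`_(d.-1))%:~R : R| => wM.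
have A0 : 0 < A by rewrite normr_gt0 intr_eq0.
have d2r : 2 <= d%:R :> R by rewrite ler_nat.
have w1 : 1 <= w by apply: le_trans wM; nra.
have /(congr1 (fun t => `|ratr t : R|)) := psi_eval z d2 a0.
rewrite /= rmorphM rmorphD rmorphM rmorphXn rmorph_sum /= !ratr_int normrM => E.
have sumb : `|\sum_(0 <= i < d.-1) ratr ((a`_i)%:~R * z ^+ i)|
    <= d.-1%:R * (M * A * w ^+ d.-1).
  apply: le_trans (ler_norm_sum _ _ _) _; rewrite big_mkord.
  apply: (@le_trans _ _ (\sum_(i < d.-1) (M * A * w ^+ d.-1))); last first.
    by rewrite sumr_const card_ord mulr_natl.
  apply: ler_sum => i _; rewrite rmorphM rmorphXn /= ratr_int normrM normrX.
  have id : (i < d)%N by rewrite (leq_trans (ltn_ord i)) ?leq_pred.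
  by apply: ler_pM => //; [exact: aM | rewrite ler_weXn2l // ltnW].
have dd : d.-1%:R <= d%:R :> R by rewrite ler_nat leq_pred.
have wd : w ^+ d = w * w ^+ d.-1 by rewrite -exprS prednK // ltnW.
have h1 : A * w ^+ d / 2 <= `|ratr (psi a).[z]| * `|(a`_0)%:~R|.
  rewrite E; set S := \sum_(_ <= _ < _) _ in sumb *.
  apply: le_trans (lerB_normD _ _); rewrite normrM normrX -/w -/A.
  have W0 : 0 <= A * w ^+ d.-1 by rewrite mulr_ge0 ?exprn_ge0 ?normr_ge0 ?ltW.
  rewrite wd; set W := w ^+ d.-1 in sumb W0 *.
  have : d.-1%:R * M * (A * W) <= w / 2 * (A * W).
    by rewrite ler_wpM2r //; nra.
  by lra.
have h2 := aM _ (ltnW d2); rewrite -/A in h2.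
have h3 := ler_wpM2l (normr_ge0 (ratr (psi a).[z] : R)) h2.
have : A * w ^+ d <= A * (2 * M * `|ratr (psi a).[z]|) by lra.
by rewrite ler_pM2l.
Qed.

(** One step gives d ln |z| - ln (2M) <= ln |psi(z)|. Subtracting ln (2M) once more and using d >= 2
    turns this into multiplication by d. The absolute value does not decrease, so the threshold
    stays passed. *)
Lemma arch_iterate (R : realType) (d : nat) (a : d.-tuple int) (M : R)
    (z : rat) (n : nat) :
  (2 <= d)%N -> a`_0 != 0 -> a`_(d.-1) != 0 -> 1 <= M ->
  (forall i, (i < d)%N -> `|(a`_i)%:~R| <= M * `|(a`_(d.-1))%:~R|) ->
  2 * d%:R * M <= `|ratr z : R| ->
  d%:R ^+ n * (ln `|ratr z| - ln (2 * M))
  <= ln `|ratr (iterate (psi a) n z) : R| - ln (2 * M).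
Proof.
move=> d2 a0 ad M1 aM; have d2r : 2 <= d%:R :> R by rewrite ler_nat.
elim: n z => [|n IHn] z wM; first by rewrite expr0 mul1r.
have := arch_step d2 a0 ad M1 aM wM; set w := `|ratr z| in wM *;
  set w1 := `|ratr _| => st.
have w0 : 0 < w by apply: lt_le_trans wM; nra.
have w10 : 0 < w1.
  have : 0 < 2 * M * w1 by apply: lt_le_trans st; rewrite exprn_gt0.
  by rewrite pmulr_rgt0 //; nra.
have ww : w <= w1.
  have h : w ^+ d >= w * w.
    rewrite -expr2 ler_weXn2l //; apply: le_trans wM; nra.
  have h' : w * (2 * M) <= w * w by rewrite ler_wpM2l ?ltW //; nra.
  have : 2 * M * w <= 2 * M * w1 by lra.
  by rewrite ler_pM2l //; nra.
rewrite iterate_rec; apply: le_trans (IHn _ (le_trans wM ww)).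
rewrite exprSr -mulrA ler_wpM2l ?exprn_ge0 // -/w1.
have M0 : 0 < 2 * M by nra.
have : ln (w ^+ d) <= ln (2 * M * w1).
  by rewrite ler_ln // posrE ?exprn_gt0 // mulr_gt0.
rewrite lnXn // lnM ?posrE // -(mulr_natl (ln w)) => h.
have l0 : 0 <= ln (2 * M) by apply: ln_ge0; lra.
have : 2 * ln (2 * M) <= d%:R * ln (2 * M) by rewrite ler_wpM2r.
by lra.
Qed.

(** Below the threshold 2dM the left side is nonpositive, so no condition on the size of [z]
    remains. *)
Lemma arch_lower (R : realType) (d : nat) (a : d.-tuple int) (M : R)
    (z : rat) (n : nat) :
  (2 <= d)%N -> a`_0 != 0 -> a`_(d.-1) != 0 -> 1 <= M ->
  (forall i, (i < d)%N -> `|(a`_i)%:~R| <= M * `|(a`_(d.-1))%:~R|) ->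
  d%:R ^+ n * (ln (Num.max 1 `|ratr z|) - ln (2 * d%:R * M))
  <= ln (Num.max 1 `|ratr (iterate (psi a) n z) : R|).
Proof.
move=> d2 a0 ad M1 aM; have d2r : 2 <= d%:R :> R by rewrite ler_nat.
have dM : 1 <= 2 * d%:R * M by nra.
have [wM|/ltW wM] := leP (2 * d%:R * M) `|ratr z : R|; last first.
  apply: (@le_trans _ _ 0); last by rewrite ln_ge0 // le_max lexx.
  rewrite mulr_ge0_le0 ?exprn_ge0 // subr_le0 ler_ln ?posrE.
  - by rewrite ge_max dM wM.
  - by rewrite lt_max ltr01.
  - exact: lt_le_trans ltr01 dM.
have w0 : 0 < `|ratr z : R| by apply: lt_le_trans wM; lra.
have M0 : 0 < 2 * M by lra.
have -> : Num.max 1 `|ratr z : R| = `|ratr z|.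
  by apply/max_idPr; apply: le_trans wM.
have := arch_iterate n d2 a0 ad M1 aM wM; set t := `|ratr (iterate _ _ _)| => H.
have l0 : 0 <= ln (2 * M) by apply: ln_ge0; lra.
have dn : 0 <= d%:R ^+ n :> R by rewrite exprn_ge0.
apply: (@le_trans _ _ (ln t)).
  suff : d%:R ^+ n * (ln `|ratr z : R| - ln (2 * d%:R * M))
     <= d%:R ^+ n * (ln `|ratr z : R| - ln (2 * M)) by lra.
  rewrite ler_wpM2l // lerD2l lerN2 ler_ln ?posrE //; last by lra.
  by nra.
have [t0|t0] := leP t 0.
  by rewrite (ln0 t0) ln_ge0 // le_max lexx.
by rewrite ler_ln ?posrE ?lt_max ?ltr01 // le_max lexx orbT.
Qed.

(** * Canonical heights *)

Lemma coef_height_ge (d : nat) (a : d.-tuple int) (i : nat) :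
  (i < d)%N -> (`|(a`_i)%R| <= coef_height a)%N.
Proof.
move=> id; apply: (@leq_bigmax_seq _ _ xpredT (fun x : int => `|x|%N)) => //.
by rewrite mem_nth // size_tuple.
Qed.

Lemma expn_leq2r (m n i : nat) : (m <= n)%N -> (m ^ i <= n ^ i)%N.
Proof. by case: i => // i; rewrite leq_exp2r. Qed.

Lemma psi_num_le (d : nat) (a : d.-tuple int) (x y : int) (T : nat) :
  (2 <= d)%N -> (`|x| <= T)%N -> (`|y| <= T)%N ->
  (`|psi_num a x y| <= d * coef_height a * T ^ d)%N.
Proof.
move=> d2 xT yT.
have term (c u v : int) (i j : nat) : (i + j)%N = d ->
    (`|c| <= coef_height a)%N -> (`|u| <= T)%N -> (`|v| <= T)%N ->
    `|c * u ^+ i * v ^+ j| <= (coef_height a * T ^ d)%:R :> int.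
  move=> ijd cH uT vT; rewrite -abszE natz lez_nat !abszM !abszX -mulnA.
  by rewrite -[X in (T ^ X)%N]ijd expnD !leq_mul // expn_leq2r.
have exp1 (u v : int) (k : nat) : u * v ^+ k = u * v ^+ k * v ^+ 0.
  by rewrite expr0 mulr1.
have -> : (d * coef_height a * T ^ d = d * (coef_height a * T ^ d))%N
  by rewrite mulnA.
suff : `|psi_num a x y| <= (d * (coef_height a * T ^ d))%:R :> int.
  by rewrite -abszE natz lez_nat.
(* One leading monomial, d - 2 middle ones and the constant one: this is the factor [d] of the
   bound. *)
have dE : d = (1 + (d.-1 - 1) + 1)%N by lia.
rewrite /psi_num [X in (X * _)%:R]dE !mulnDl !mul1n !natrD.
apply: le_trans (ler_normD _ _) _; apply: lerD; last first.
  rewrite exp1; apply: term => //; first by rewrite addn0.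
  by apply: coef_height_ge; exact: ltnW.
apply: le_trans (ler_normD _ _) _; apply: lerD.
  rewrite exp1; apply: term => //; first by rewrite addn0.
  by apply: coef_height_ge; rewrite prednK // ltnW.
apply: le_trans (ler_norm_sum _ _ _) _.
rewrite natrM mulr_natl -sumr_const_nat.
apply: ler_sum_nat => i /andP[i1 i2]; apply: term => //; first by lia.
by apply: coef_height_ge; lia.
Qed.

Lemma coprime_denq (z : rat) : coprime `|denq z| `|numq z|.
Proof. by rewrite coprime_sym coprime_num_den. Qed.

(** The fraction F/(a_0 y^d) represents psi(z), and reducing it to lowest terms can only lower the
    height. *)
Lemma weil_step_le (R : realType) (d : nat) (a : d.-tuple int) (z : rat) :
  (2 <= d)%N -> a`_0 != 0 ->
  weil_height R (psi a).[z]
  <= d%:R * weil_height R z + ln (d * coef_height a)%:R.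
Proof.
move=> d2 a0; rewrite /weil_height; set T := maxn `|numq z| `|denq z|.
have st := psi_step z d2 a0; set f := (psi a).[z] in st *.
have T0 : (0 < T)%N by rewrite leq_max absz_denq_gt0 orbT.
have H0 : (0 < coef_height a)%N.
  by apply: leq_trans (coef_height_ge a (ltnW d2)); rewrite absz_gt0.
have dH0 : (0 < d * coef_height a)%N by rewrite muln_gt0 H0 ltnW.
rewrite mulr_natl -lnXn ?ltr0n // -lnM ?posrE ?exprn_gt0 ?ltr0n //.
rewrite -natrX -natrM ler_ln ?posrE ?ltr0n ?muln_gt0 ?expn_gt0 ?T0 ?leq_max
  ?absz_denq_gt0 ?orbT //; last by rewrite H0 ltnW.
rewrite ler_nat [leqRHS]mulnC geq_max.
have G0 : (0 < `|(a`_0 * denq z ^+ d)%R|)%N.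
  by rewrite absz_gt0 mulf_neq0 // expf_neq0 // denq_neq0.
apply/andP; split.
  have F := psi_num_le a d2 (leq_maxl _ _ : `|numq z| <= T)%N
    (leq_maxr _ _ : `|denq z| <= T)%N.
  apply: leq_trans F; have [F0|F0] := eqVneq (psi_num a (numq z) (denq z)) 0.
    move/eqP: st; rewrite F0 mul0r mulf_eq0 => /orP[/eqP-> //|/eqP G].
    by rewrite G in G0.
  rewrite dvdn_leq ?absz_gt0 // -(@Gauss_dvdl _ _ `|denq f|) ?coprime_num_den //.
  by rewrite -abszM -st abszM dvdn_mulr.
apply: (@leq_trans `|(a`_0 * denq z ^+ d)%R|).
  rewrite dvdn_leq // -(@Gauss_dvdr _ `|numq f|) ?coprime_denq //.
  by rewrite -abszM st abszM dvdn_mull.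
rewrite abszM abszX leq_mul //.
  apply: leq_trans (coef_height_ge a (ltnW d2)) _.
  by rewrite leq_pmull // ltnW.
by rewrite leq_exp2r ?leq_maxr // ltnW.
Qed.

Lemma weil_height_ge0 (R : realType) (z : rat) : 0 <= weil_height R z.
Proof. exact: ln_nat_ge0. Qed.

Lemma cvg_geometric_inv (R : realType) (d : nat) (C : R) : (2 <= d)%N ->
  (fun n : nat => d%:R ^- n * C) @ \oo --> (0 : R).
Proof.
move=> d2; rewrite -[X in _ --> X](mul0r C); apply: cvgM; last exact: cvg_cst.
under eq_fun do rewrite -exprVn.
apply: cvg_expr; rewrite normfV ger0_norm // invf_lt1 ?ltr0n ?ltr1n //.
exact: ltnW.
Qed.

(** After adding K = max(C, 0) to [h] the scaled sequence is nonincreasing, because C + K <= 2K <=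
    dK, and it is bounded below by 0. *)
Lemma scaled_le_cvg (R : realType) (d : nat) (C : R) (h : nat -> R) :
  (2 <= d)%N -> (forall n, 0 <= h n) -> (forall n, h n.+1 <= d%:R * h n + C) ->
  cvgn (fun n => d%:R ^- n * h n).
Proof.
move=> d2 h0 hS; pose K := Num.max C 0.
have d2r : 2 <= d%:R :> R by rewrite ler_nat.
have K0 : 0 <= K by rewrite le_max lexx orbT.
have -> : (fun n => d%:R ^- n * h n) =
    (fun n => d%:R ^- n * (h n + K)) \- (fun n => d%:R ^- n * K).
  by apply/funext => n /=; rewrite mulrDr addrK.
apply: is_cvgB; last by apply/cvg_ex; exists 0; exact: cvg_geometric_inv.
apply: nonincreasing_is_cvgn.
  apply/nonincreasing_seqP => n.
  rewrite /= exprS invfM [X in X * _ <= _]mulrC -mulrA ler_wpM2l ?invr_ge0 ?exprn_ge0 //.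
  rewrite mulrC ler_pdivrMr; last by lra.
  have : C <= K by rewrite le_max lexx.
  by have := hS n; nra.
exists 0 => _ [n _ <-]; rewrite mulr_ge0 ?invr_ge0 ?exprn_ge0 // addr_ge0 //.
Qed.

Section CanonicalHeight.

Variables (R : realType) (d : nat) (a : d.-tuple int).
Hypotheses (d2 : (2 <= d)%N) (a0 : a`_0 != 0).

Let hn (z : rat) (n : nat) : R := weil_height R (iterate (psi a) n z).

Lemma canonical_height_cvg (z : rat) :
  (fun n => d%:R ^- n * hn z n) @ \oo --> canonical_height R d (psi a) z.
Proof.
apply: (scaled_le_cvg (C := ln (d * coef_height a)%:R)) => // n.
  exact: weil_height_ge0.
exact: weil_step_le.
Qed.

Lemma canonical_height_ge (z : rat) (c D : R) :
  (forall n, d%:R ^+ n * c - D <= hn z n) ->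
  c <= canonical_height R d (psi a) z.
Proof.
move=> H; rewrite -(subr0 c).
have cv : (fun n => c - d%:R ^- n * D) @ \oo --> c - 0.
  by apply: cvgB; [exact: cvg_cst | exact: cvg_geometric_inv].
apply: (@ler_cvg_to _ \oo _ R _ _ _ _ cv (@canonical_height_cvg z));
  apply: nearW => n.
have dn : 0 < d%:R ^+ n :> R by rewrite exprn_gt0 // ltr0n ltnW.
by rewrite -(ler_pM2l dn) mulrBr !mulVKf ?gt_eqF.
Qed.

Lemma canonical_height_le (z : rat) (c D : R) :
  (forall n, hn z n <= d%:R ^+ n * c + D) ->
  canonical_height R d (psi a) z <= c.
Proof.
move=> H; rewrite -(addr0 c).
have cv : (fun n => c + d%:R ^- n * D) @ \oo --> c + 0.
  by apply: cvgD; [exact: cvg_cst | exact: cvg_geometric_inv].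
apply: (@ler_cvg_to _ \oo _ R _ _ _ _ (@canonical_height_cvg z) cv);
  apply: nearW => n.
have dn : 0 < d%:R ^+ n :> R by rewrite exprn_gt0 // ltr0n ltnW.
by rewrite -(ler_pM2l dn) mulrDr !mulVKf ?gt_eqF.
Qed.

Lemma canonical_height_psi (z : rat) :
  canonical_height R d (psi a) (psi a).[z]
  = d%:R * canonical_height R d (psi a) z.
Proof.
have := @canonical_height_cvg z; rewrite -(cvg_shiftS _ _) => cv.
apply: cvg_unique (@canonical_height_cvg _) _ => //.
have -> : (fun n => d%:R ^- n * hn (psi a).[z] n) =
    (fun n => d%:R * (d%:R ^- n.+1 * hn z n.+1)).
  apply/funext => n; rewrite /hn iterate_rec mulrA exprS invfM mulVKf //.
  by rewrite pnatr_eq0 -lt0n ltnW.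
by apply: cvgM => //; exact: cvg_cst.
Qed.

(** The heights along a finite orbit are bounded. This serves to show that 0 is not preperiodic once
    its canonical height is positive. *)
Lemma canonical_height_Prep (z : rat) :
  Prep (psi a) z -> canonical_height R d (psi a) z <= 0.
Proof.
move=> [l [m [m1 E]]]; pose D := \sum_(0 <= n < l + m) hn z n.
apply: (canonical_height_le (D := D)) => n; rewrite mulr0 add0r.
elim/ltn_ind: n => n IHn; have [nl|nl] := ltnP n (l + m).
  rewrite /D (bigD1_seq n) /= ?iota_uniq ?mem_index_iota //.
  by rewrite lerDl sumr_ge0 // => i _; exact: weil_height_ge0.
have -> : hn z n = hn z (n - m)%N.
  rewrite /hn -(subnK nl); congr (weil_height _ _).
  set k := (n - (l + m))%N.
  have -> : (k + (l + m) - m = k + l)%N by lia.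
  by rewrite /iterate !iterD; congr iter; move: E; rewrite /iterate iterD.
by apply: IHn; lia.
Qed.

End CanonicalHeight.

Lemma canonical_height_lower (R : realType) (d : nat) (a : d.-tuple int)
    (z : rat) (M : R) (c : nat -> R) (K : nat) :
  (2 <= d)%N -> a`_0 != 0 -> a`_(d.-1) != 0 -> 1 <= M ->
  (forall i, (i < d)%N -> `|(a`_i)%:~R| <= M * `|(a`_(d.-1))%:~R|) ->
  (forall p, prime p -> grows d (psi a) p z (c p)) ->
  \sum_(0 <= p < K | prime p) c p * ln p%:R
    + (ln (Num.max 1 `|ratr z|) - ln (2 * d%:R * M))
  <= canonical_height R d (psi a) z.
Proof.
move=> d2 a0 ad M1 aM cg; have [D H] := grows_sum K cg.
apply: (canonical_height_ge d2 a0 (D := D)) => n.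
have := arch_lower z n d2 a0 ad M1 aM; have := H n.
by rewrite weil_heightE mulrDr; lra.
Qed.

(** A crude bound, uniform in [z] for fixed [a], which is all that the finiteness argument for
    lambda_1 requires. As a_d is a nonzero integer, M may be taken to be the coefficient height. *)
Lemma canonical_height_ge_weil (R : realType) (d : nat) (a : d.-tuple int)
    (z : rat) :
  (2 <= d)%N -> a`_0 != 0 -> a`_(d.-1) != 0 ->
  weil_height R z - ln `|(a`_(d.-1))%R|%:R - ln (2 * d%:R * (coef_height a)%:R)
  <= canonical_height R d (psi a) z.
Proof.
move=> d2 a0 ad; set A := `|_|%N; pose K := maxn `|denq z| A.
have A0 : (0 < A)%N by rewrite absz_gt0.
have AH : (A <= coef_height a)%N by apply: coef_height_ge;
  rewrite prednK // ltnW.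
have H1 : 1 <= (coef_height a)%:R :> R by rewrite ler1n; apply: leq_trans AH.
(* If k <= v_p(a_d) this is nonpositive and the bound is trivial; otherwise z already escapes at
   [p], and k + (r - v)/(d - 1) >= k - v. *)
pose c p : R := (denv p z)%:R - (logn p A)%:R.
have := @canonical_height_lower R d a z (coef_height a)%:R c K.+1 d2 a0 ad H1.
have -> : \sum_(0 <= p < K.+1 | prime p) c p * ln p%:R
    = ln `|denq z|%:R - ln A%:R :> R.
  rewrite (ln_natE R A0 (leq_maxr _ _ : A <= K)%N).
  rewrite (ln_natE R (absz_denq_gt0 z) (leq_maxl _ _ : `|denq z| <= K)%N).
  by rewrite -sumrB; apply: eq_bigr => p _; rewrite mulrBl.
rewrite weil_heightE => H; apply: le_trans (H _ _).
- by rewrite le_eqVlt; apply/orP; left; apply/eqP; ring.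
- move=> i id; rewrite -!intr_norm -!natr_absz.
  rewrite -natrM ler_nat -/A (leq_trans (coef_height_ge a id)) //.
  by rewrite leq_pmulr.
- move=> p pp; rewrite /c; have [kv|vk] := leqP (denv p z) (logn p A).
    by apply: grows_le0; rewrite subr_le0 ler_nat.
  have d1 : (1 <= d.-1)%N by lia.
  apply: grows_le (grows_denv _ d2 a0 ad pp _ _).
  + rewrite -/A lerD2l; apply: (@le_trans _ _ (- (logn p A)%:R / d.-1%:R)).
      rewrite mulNr lerN2 ler_pdivrMr ?ltr0n // ler_peMr ?ler0n //.
      by rewrite ler1n.
    by rewrite ler_wpM2r ?invr_ge0 // lerDr.
  + by rewrite -/A; lia.
  + by rewrite -/A (leq_trans (ltnW vk)) // leq_pmull.
Qed.

Lemma canonical_height_le_weil (R : realType) (d : nat) (a : d.-tuple int)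
    (z : rat) :
  (2 <= d)%N -> a`_0 != 0 ->
  canonical_height R d (psi a) z
  <= weil_height R z + ln (d * coef_height a)%:R / (d%:R - 1).
Proof.
move=> d2 a0; set C := ln _; set E := C / _.
have d2r : 2 <= d%:R :> R by rewrite ler_nat.
have C0 : 0 <= C by exact: ln_nat_ge0.
(* [E] is chosen so that dh + C + E = d(h + E): the shifted height h + E is multiplied by at most d
   at each step. *)
have CE : C = d%:R * E - E by rewrite /E; field; lra.
have E0 : 0 <= E by apply: divr_ge0 => //; lra.
suff H n w : weil_height R (iterate (psi a) n w)
    <= d%:R ^+ n * (weil_height R w + E) - E.
  apply: (canonical_height_le d2 a0 (D := 0)) => n; rewrite addr0.
  by apply: le_trans (H n z) _; rewrite lerBlDr lerDl.
elim: n w => [|n IHn] w; first by rewrite expr0 mul1r addrK.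
rewrite iterate_rec; apply: le_trans (IHn _) _.
rewrite lerD2r exprSr -mulrA ler_wpM2l ?exprn_ge0 //.
by have := weil_step_le R w d2 a0; rewrite -/C; lra.
Qed.

Lemma psi_horner0 (d : nat) (a : d.-tuple int) :
  (2 <= d)%N -> a`_0 != 0 -> (psi a).[0] = 1.
Proof.
move=> d2 a0; rewrite /psi !hornerD hornerZ hornerXn hornerC horner_sum.
rewrite expr0n; case: d d2 a a0 => // d d2 a a0; rewrite mulr0 add0r.
rewrite big_nat big1 ?add0r // => i /andP[i1 _].
by rewrite hornerZ hornerXn expr0n -[i]prednK // mulr0.
Qed.

Lemma weil_height1 (R : realType) : weil_height R 1 = 0.
Proof. by rewrite /weil_height /= ln1. Qed.

Lemma canonical_height0_le (R : realType) (d : nat) (a : d.-tuple int) :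
  (2 <= d)%N -> a`_0 != 0 ->
  canonical_height R d (psi a) 0
  <= ln (d * coef_height a)%:R / (d%:R * (d%:R - 1)).
Proof.
move=> d2 a0; have d2r : 2 <= d%:R :> R by rewrite ler_nat.
have d0 : 0 < d%:R :> R by lra.
rewrite -(ler_pM2l d0) -canonical_height_psi // psi_horner0 //.
apply: le_trans (canonical_height_le_weil R 1 d2 a0) _.
rewrite weil_height1 add0r le_eqVlt; apply/orP; left; apply/eqP.
by field; apply/andP; split; lra.
Qed.

(** * Northcott's finiteness property and the existence of the minimum *)

Lemma finite_weil_height (R : realType) (B : R) :
  finite_set [set z : rat | weil_height R z <= B].
Proof.
pose K := Num.truncn (expR B).
(* Numerators range over [-K, K] and are shifted by [K] to be indexed by naturals; the index 0 among
   the denominators is harmless. *)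
apply: (@sub_finite_set _ _ [set (x.1%:Z - K%:Z)%:~R / (x.2%:Z)%:~R | x in
    [set: 'I_(2 * K).+1 * 'I_K.+1]]); last exact: finite_image finite_finset.
move=> z /= zB; have zK : (maxn `|numq z| `|denq z| <= K)%N.
  rewrite /K truncn_ge_nat ?expR_ge0 //.
  rewrite -ler_ln ?posrE ?expR_gt0 ?expRK //.
  by rewrite ltr0n leq_max absz_denq_gt0 orbT.
have x2 : (`|(numq z + K%:Z)%R| < (2 * K).+1)%N by lia.
have y2 : (`|denq z| < K.+1)%N by lia.
exists (Ordinal x2, Ordinal y2) => //=.
have -> : (`|denq z|%N)%:Z = denq z by rewrite gtz0_abs // denq_gt0.
have -> : (`|(numq z + K%:Z)%R|%N)%:Z - K%:Z = numq z by lia.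
exact: divq_num_den.
Qed.

Lemma finite_argmin (R : realType) (T : choiceType) (S : set T) (h : T -> R) :
  finite_set S -> S !=set0 -> exists2 x, S x & forall y, S y -> h x <= h y.
Proof.
move=> /finite_seqP[s ->] [x0 /= x0s]; elim: s x0 x0s => // y s IHs x0 _.
case: s IHs => [|y' s] IHs.
  by exists y; rewrite /= ?mem_seq1 // => w; rewrite mem_seq1 => /eqP->.
have [x xs xm] := IHs y' (mem_head _ _).
have [xy|yx] := leP (h x) (h y).
  exists x; first by rewrite /= inE xs orbT.
  by move=> w /=; rewrite inE => /orP[/eqP->|/xm].
exists y; first by rewrite /= mem_head.
move=> w /=; rewrite inE => /orP[/eqP->//|/xm].
by apply: le_trans; exact: ltW.
Qed.

(** Only points of canonical height at most that of [z0] compete, and they have bounded Weil height,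
    hence are finitely many. So the minimum exists and [xget] does not return its default value
    0. *)
Lemma lambda1_attained (R : realType) (d : nat) (a : d.-tuple int) (z0 : rat) :
  (2 <= d)%N -> a`_0 != 0 -> a`_(d.-1) != 0 -> ~ Prep (psi a) z0 ->
  exists2 z, lambda1 R d (psi a) = canonical_height R d (psi a) z
           & lambda1 R d (psi a) <= canonical_height R d (psi a) z0.
Proof.
move=> d2 a0 ad z0P; pose h := canonical_height R d (psi a).
pose S := [set z : rat | ~ Prep (psi a) z /\ h z <= h z0].
have [||m [mP mz0] mmin] := @finite_argmin R _ S h.
- apply: sub_finite_set (finite_weil_height (h z0 + ln `|(a`_(d.-1))%R|%:R
    + ln (2 * d%:R * (coef_height a)%:R))) => z [_ zz] /=.
  have := canonical_height_ge_weil R z d2 a0 ad; rewrite -/(h z).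
  by lra.
- by exists z0.
have : ([set h z | z in ~` Prep (psi a)] `&`
        lbound [set h z | z in ~` Prep (psi a)]) (lambda1 R d (psi a)).
  apply: xgetPex; exists (h m); split; first by exists m.
  move=> _ [w wP <-]; have [ww|/ltW ww] := leP (h w) (h z0); first exact: mmin.
  exact: le_trans mz0 ww.
move=> [[z zP zE] lb]; exists z; first exact: esym zE.
by apply: lb; exists z0.
Qed.

(** * Lower bounds for generic coefficients *)

Lemma squarefree_factor (n : nat) : (0 < n)%N ->
  exists m t : nat, n = (m ^ 2 * t)%N /\ (forall p, logn p t <= 1)%N.
Proof.
move=> n0; pose P m := (m ^ 2 %| n)%N.
have bnd m : P m -> (m <= n)%N.
  move=> /(dvdn_leq n0); apply: leq_trans.
  by case: m => // m; rewrite -{1}[m.+1]expn1 leq_pexp2l.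
have [m /dvdnP[t nE] mmax] := ex_maxnP (ex_intro P 1%N (dvd1n n)) bnd.
exists m, t; split=> [|p]; first by rewrite mulnC.
have t0 : (0 < t)%N by move: n0; rewrite nE muln_gt0 => /andP[].
have m0 : (0 < m)%N by move: n0;
  rewrite nE muln_gt0 expn_gt0 => /andP[_ /orP[]].
have [pp|pp] := boolP (prime p); last by rewrite lognE (negbTE pp).
rewrite leqNgt -pfactor_dvdn //; apply/negP => pt.
have : P (m * p)%N by rewrite /P expnMn nE mulnC dvdn_mul.
by move=> /mmax; rewrite leqNgt -{1}[m]muln1 ltn_pmul2l // prime_gt1.
Qed.

(** Write n = m^2 t with t squarefree and take q = t / gcd(t, mA), which removes the primes dividing
    m or A. The removed factor divides m gcd(n, A), whence the total loss m^3 gcd(n, A). *)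
Lemma squarefree_unit_part (n A : nat) : (0 < n)%N -> (0 < A)%N ->
  exists q m : nat, [/\ (0 < q)%N, (q %| n)%N, (m ^ 2 %| n)%N,
    (n <= q * m ^ 3 * gcdn n A)%N
    & forall p, prime p -> (p %| q)%N -> logn p n = 1 /\ logn p A = 0]%N.
Proof.
move=> n0 A0; have [m [t [nE tsf]]] := squarefree_factor n0.
have /andP[m20 t0] : (0 < m ^ 2)%N && (0 < t)%N by rewrite -muln_gt0 -nE.
have m0 : (0 < m)%N by move: m20; rewrite expn_gt0 orbF.
pose g := gcdn t (m * A); have gt : (g %| t)%N by exact: dvdn_gcdl.
have qE : (t %/ g * g = t)%N by rewrite divnK.
have q0 : (0 < t %/ g)%N
  by rewrite -(ltn_pmul2r (m := g)) ?mul0n ?qE ?gcdn_gt0 ?t0.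
exists (t %/ g)%N, m; split => //.
- by rewrite nE dvdn_mull // -{2}qE dvdn_mulr.
- by rewrite nE dvdn_mulr.
- have : (g <= m * gcdn n A)%N.
    apply: dvdn_leq; first by rewrite muln_gt0 m0 gcdn_gt0 n0.
    rewrite muln_gcdr dvdn_gcd dvdn_gcdr andbT dvdn_mull // nE dvdn_mull //.
  have -> : (t %/ g * m ^ 3 * gcdn n A = m ^ 2 * (t %/ g * (m * gcdn n A)))%N by ring.
  by move=> gle; rewrite {1}nE -{1}qE !leq_mul.
move=> p pp pq;
  have : (0 < logn p (t %/ g))%N by rewrite logn_gt0 mem_primes pp q0.
have mA0 : (0 < m * A)%N by rewrite muln_gt0 m0.
rewrite logn_div // logn_gcd // lognM // nE lognM // lognX.
by have := tsf p; lia.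
Qed.

(** A prime dividing both q/gcd(q, w) and w also divides gcd(q, w), so its square would divide q. *)
Lemma coprime_divn_gcdn (q w : nat) : (0 < q)%N ->
  (forall p, logn p q <= 1)%N -> coprime (q %/ gcdn q w) w.
Proof.
move=> q0 qsf; set A := gcdn q w;
  have qE : (q %/ A * A = q)%N by rewrite divnK ?dvdn_gcdl.
rewrite /coprime; apply/negPn/negP => g1; set g := gcdn _ _ in g1.
have g0 : (0 < g)%N.
  by rewrite gcdn_gt0 -(ltn_pmul2r (m := A)) ?mul0n ?qE ?q0 // gcdn_gt0 q0.
have pp : prime (pdiv g) by rewrite pdiv_prime //; case: (g) g0 g1 => [|[]].
set p := pdiv g in pp.
have pB : (p %| q %/ A)%N by apply: dvdn_trans (pdiv_dvd _) (dvdn_gcdl _ _).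
have pw : (p %| w)%N by apply: dvdn_trans (pdiv_dvd _) (dvdn_gcdr _ _).
have pA : (p %| A)%N.
  by rewrite dvdn_gcd pw andbT; apply: dvdn_trans pB _;
    rewrite -{2}qE dvdn_mulr.
have : (p ^ 2 %| q)%N by rewrite -qE dvdn_mul.
by rewrite pfactor_dvdn // ltnNge qsf.
Qed.

(** By [psi_step], B divides F times the denominator of psi(z), to which it is prime; and F is
    congruent to x Q modulo a_0. *)
Lemma psi_cof_dvd (d : nat) (a : d.-tuple int) (z : rat) (B : nat) :
  (2 <= d)%N -> a`_0 != 0 -> (B %| `|(a`_0)%R|)%N ->
  coprime B `|denq (psi a).[z]| ->
  (B %| `|numq z| * `|psi_cof a (numq z) (denq z)|)%N.
Proof.
move=> d2 a0 Ba0 By1; rewrite -abszM.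
have -> : numq z * psi_cof a (numq z) (denq z)
    = psi_num a (numq z) (denq z) - a`_0 * denq z ^+ d.
  by rewrite psi_numE ?addrK // ltnW.
have BF : (B %| `|psi_num a (numq z) (denq z)|)%N.
  rewrite -(Gauss_dvdl _ By1) -abszM -psi_step // !abszM.
  by rewrite dvdn_mull // dvdn_mulr.
have : (B%:Z %| psi_num a (numq z) (denq z) - a`_0 * denq z ^+ d)%Z.
  by rewrite rpredB // ?dvdz_mulr // dvdzE.
by rewrite dvdzE.
Qed.

Lemma logn_dvd1 (p q n : nat) :
  (0 < n)%N -> (q %| n)%N ->
  (prime p -> (p %| q)%N -> logn p n = 1%N) -> (logn p q <= 1)%N.
Proof.
move=> n0 qn H; have [pp|pp] := boolP (prime p);
  last by rewrite lognE (negbTE pp).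
have [/(H pp) <-|pq] := boolP (p %| q)%N; first exact: dvdn_leq_log.
by rewrite lognE (negbTE pq) !andbF.
Qed.

Lemma denv_gt0 (p : nat) (z : rat) :
  prime p -> (0 < denv p z)%N = (p %| `|denq z|)%N.
Proof. by move=> pp; rewrite logn_gt0 mem_primes pp absz_denq_gt0. Qed.

Lemma grows_unit (R : realType) (d : nat) (a : d.-tuple int) (z : rat)
    (p : nat) :
  (2 <= d)%N -> a`_0 != 0 -> a`_(d.-1) != 0 -> prime p ->
  logn p `|(a`_0)%R| = 1%N -> logn p `|(a`_(d.-1))%R| = 0%N ->
  (0 < denv p z)%N ->
  grows d (psi a) p z ((denv p z)%:R + d.-1%:R^-1 : R).
Proof.
move=> d2 a0 ad pp r1 v0 k0; rewrite -(mul1r d.-1%:R^-1).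
have := @grows_denv R d a z p d2 a0 ad pp; rewrite /= r1 v0 subr0.
by apply => //; rewrite muln_gt0.
Qed.

(** The primes of the gcd give the term over d - 1 because z or psi(z) escapes there. The number [e]
    absorbs the repeated prime factors of a_d, so that half of the Weil height survives. *)
Lemma canonical_height_lower_ge3 (R : realType) (d : nat) (a : d.-tuple int)
    (z : rat) (M : R) (q e : nat) :
  (3 <= d)%N -> a`_0 != 0 -> a`_(d.-1) != 0 -> 1 <= M ->
  (forall i, (i < d)%N -> `|(a`_i)%:~R| <= M * `|(a`_(d.-1))%:~R|) ->
  (0 < q)%N -> (q %| `|(a`_0)%R|)%N ->
  (forall p, prime p -> (p %| q)%N ->
    logn p `|(a`_0)%R| = 1 /\ logn p `|(a`_(d.-1))%R| = 0)%N ->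
  (0 < e)%N -> (forall p, logn p `|(a`_(d.-1))%R| <= (logn p e).+1)%N ->
  ln (gcdn q (`|denq z| * `|denq (psi a).[z]|))%:R / d.-1%:R
    + (weil_height R z - ln e%:R) / 2 - ln (2 * d%:R * M)
  <= canonical_height R d (psi a) z.
Proof.
move=> d3 a0 ad M1 aM q0 qa0 qp e0 ep; have d2 : (2 <= d)%N by exact: ltnW.
set A := gcdn _ _; have Aq : (A %| q)%N by exact: dvdn_gcdl.
have A0 : (0 < A)%N by rewrite gcdn_gt0 q0.
have d1r : 2 <= d.-1%:R :> R by rewrite ler_nat; lia.
pose c p : R := (logn p A)%:R / d.-1%:R + ((denv p z)%:R - (logn p e)%:R) / 2.
pose K := (A + e + `|denq z|)%N.
have cg p : prime p -> grows d (psi a) p z (c p).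
  move=> pp; have [pA|pA] := boolP (p %| A)%N.
    have [r1 v0] := qp p pp (dvdn_trans pA Aq).
    have A1 : (logn p A <= 1)%N.
      by apply: (logn_dvd1 (n := `|(a`_0)%R|)) => //;
        [rewrite absz_gt0 | exact: dvdn_trans Aq qa0].
    have A1r : (logn p A)%:R / d.-1%:R <= d.-1%:R^-1 :> R.
      by rewrite ler_piMl ?invr_ge0 ?lern1.
    have e0r : 0 <= (logn p e)%:R :> R by [].
    have [k0|k0] := posnP (denv p z).
      have k1 : (0 < denv p (psi a).[z])%N.
        have : (p %| `|denq z| * `|denq (psi a).[z]|)%N.
          exact: dvdn_trans pA (dvdn_gcdr _ _).
        by rewrite Euclid_dvdM // -!denv_gt0 // k0.
      (* Going back from psi(z) to z divides the bound by d, and 1 + 1/(d - 1) = d/(d - 1) leaves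
         exactly 1/(d - 1). *)
      apply: grows_shift; apply: grows_le (grows_unit R d2 a0 ad pp r1 v0 k1).
      have : 1 <= (denv p (psi a).[z])%:R :> R by rewrite ler1n.
      have -> : d%:R = d.-1%:R + 1 :> R by rewrite natr1 prednK // ltnW.
      have : c p <= d.-1%:R^-1 by rewrite /c k0; lra.
      have : d.-1%:R * d.-1%:R^-1 = 1 :> R by rewrite divff //; lra.
      by nra.
    apply: grows_le (grows_unit R d2 a0 ad pp r1 v0 k0).
    by rewrite /c; have : 0 <= (denv p z)%:R :> R by []; lra.
  have lA : logn p A = 0%N by rewrite lognE (negbTE pA) !andbF.
  rewrite /c lA mul0r add0r; have [ke|ek] := leqP (denv p z) (logn p e).
    by apply: grows_le0;
      have : (denv p z)%:R <= (logn p e)%:R :> R by [rewrite ler_nat]; lra.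
  have v1 := ep p; set v := logn p `|(a`_(d.-1))%R| in v1.
  have vk : (v <= denv p z)%N by lia.
  apply: grows_le (grows_denv R d2 a0 ad pp _ _); rewrite -/v.
  - set r := logn p `|(a`_0)%R|; set k := denv p z in ek vk *.
    have v1r : v%:R <= (logn p e)%:R + 1 :> R by rewrite natr1 ler_nat.
    have k1r : 1 <= k%:R :> R by rewrite ler1n; lia.
    (* Here d >= 3 enters. Since v <= v_p(e) + 1 and k >= 1, the resulting k - v/2 is at least (k -
       v_p(e))/2. *)
    have h1 : v%:R / d.-1%:R <= v%:R / 2 :> R.
      by rewrite ler_wpM2l // lef_pV2 ?posrE //; lra.
    have h2 : 0 <= r%:R / d.-1%:R :> R by rewrite divr_ge0.
    by rewrite [(r%:R - _) / _]mulrBl; lra.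
  - by lia.
  - by rewrite (leq_trans vk) // leq_pmull //; lia.
have := @canonical_height_lower R d a z M c K.+1 d2 a0 ad M1 aM cg.
apply: le_trans; rewrite weil_heightE.
have AK : (A <= K)%N by rewrite /K; lia.
have eK : (e <= K)%N by rewrite /K; lia.
have yK : (`|denq z| <= K)%N by rewrite /K; lia.
have -> : \sum_(0 <= p < K.+1 | prime p) c p * ln p%:R
    = ln A%:R / d.-1%:R + (ln `|denq z|%:R - ln e%:R) / 2 :> R.
  rewrite (ln_natE R A0 AK) (ln_natE R e0 eK) (ln_natE R (absz_denq_gt0 z) yK).
  rewrite -sumrB !mulr_suml -big_split /=; apply: eq_bigr => p _.
  by rewrite /c /denv; ring.
(* Half of the archimedean term completes half of the Weil height; the other half is discarded. *)
have : 0 <= ln (Num.max 1 `|ratr z : R|) by rewrite ln_ge0 // le_max lexx.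
by lra.
Qed.

Lemma coprime_denq_prime (p : nat) (z : rat) :
  prime p -> denv p z = 0%N -> coprime p `|denq z|.
Proof. by move=> pp k0; rewrite prime_coprime // -denv_gt0 // k0. Qed.

(** * The quadratic case, where entry 1 is the leading coefficient *)

Lemma quadratic_dvd_num (a : 2.-tuple int) (z : rat) (p : nat) :
  a`_0 != 0 -> prime p -> (p %| `|(a`_0)%R|)%N -> ~~ (p %| `|(a`_1)%R|)%N ->
  denv p (psi a).[z] = 0%N -> (p %| `|numq z|)%N.
Proof.
move=> a0 pp pa0 pa1 k1.
have := psi_cof_dvd (isT : (2 <= 2)%N) a0 pa0 (coprime_denq_prime pp k1).
rewrite /psi_cof big_geq // addr0 expr1 abszM !Euclid_dvdM // (negbTE pa1) /=.
by rewrite orbb.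
Qed.

(* If p divides a_0 exactly, then z = 0 mod p would give psi(z) = 1 mod p when
   d = 2, so that z, psi(z) and psi(psi(z)) cannot all be p-integral. *)
Lemma quadratic_denv_gt0 (a : 2.-tuple int) (z : rat) (p : nat) :
  a`_0 != 0 -> prime p -> logn p `|(a`_0)%R| = 1%N ->
  ~~ (p %| `|(a`_1)%R|)%N ->
  denv p z = 0%N -> denv p (psi a).[z] = 0%N ->
  (0 < denv p (psi a).[(psi a).[z]])%N.
Proof.
move=> a0 pp r1 pa1 k0 k1; rewrite lt0n; apply/negP => /eqP k2.
have a00 : (0 < `|(a`_0)%R|)%N by rewrite absz_gt0.
have pa0 : (p %| `|(a`_0)%R|)%N by rewrite -(expn1 p) pfactor_dvdn // r1.
have px := quadratic_dvd_num a0 pp pa0 pa1 k1.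
have px1 := quadratic_dvd_num a0 pp pa0 pa1 k2.
have cy : coprime (p ^ 2) (`|denq z| ^ 2).
  by apply/coprimeXl/coprimeXr/coprime_denq_prime.
have cy1 : coprime (p ^ 2) `|denq (psi a).[z]|.
  by apply/coprimeXl/coprime_denq_prime.
(* Here [p] divides both a_0 and the numerator of psi(z). Since p^2 also divides a_2 x^2, it would
   divide a_0 y^2, against v_p(a_0) = 1. *)
have pF : (p ^ 2 %| `|psi_num a (numq z) (denq z)|)%N.
  rewrite -(Gauss_dvdl _ cy1) -abszM -psi_step // !abszM expnS expn1.
  by rewrite dvdn_mul // dvdn_mulr.
have : ((p ^ 2)%N%:Z %| psi_num a (numq z) (denq z) - a`_1 * numq z ^+ 2)%Z.
  apply: rpredB; first by rewrite dvdzE.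
  by apply: dvdz_mull; rewrite dvdzE abszX dvdn_exp2r.
rewrite /psi_num big_geq // addr0 addrC addKr dvdzE abszM abszX Gauss_dvdl //.
by rewrite pfactor_dvdn // r1.
Qed.

Lemma canonical_height_lower_eq2 (R : realType) (a : 2.-tuple int)
    (z : rat) (M : R) (q : nat) :
  a`_0 != 0 -> a`_1 != 0 -> 1 <= M ->
  (forall i, (i < 2)%N -> `|(a`_i)%:~R| <= M * `|(a`_1)%:~R|) ->
  (0 < q)%N -> (q %| `|(a`_0)%R|)%N ->
  (forall p, prime p -> (p %| q)%N ->
    logn p `|(a`_0)%R| = 1 /\ logn p `|(a`_1)%R| = 0)%N ->
  ln q%:R / 2 - ln (4 * M) <= canonical_height R 2 (psi a) z.
Proof.
move=> a0 ad M1 aM q0 qa0 qp; pose c p : R := (logn p q)%:R / 2.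
have cg p : prime p -> grows 2 (psi a) p z (c p).
  move=> pp; have [pq|pq] := boolP (p %| q)%N; last first.
    apply: grows_le0; rewrite /c.
    have -> : logn p q = 0%N by rewrite lognE (negbTE pq) !andbF.
    by rewrite mul0r.
  have [r1 v0] := qp p pp pq.
  have q1 : (logn p q <= 1)%N.
    by apply: (logn_dvd1 (n := `|(a`_0)%R|)) => //; rewrite absz_gt0.
  have c1 : c p <= 2^-1 by rewrite /c ler_piMl ?invr_ge0 ?lern1.
  have pa1 : ~~ (p %| `|(a`_1)%R|)%N.
    by rewrite -(expn1 p) pfactor_dvdn ?absz_gt0 // v0.
  have gr w : (0 < denv p w)%N -> grows 2 (psi a) p w (2 : R).
    move=> w0; apply: grows_le (grows_unit R _ a0 ad pp r1 v0 w0) => //=.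
    by rewrite invr1; have : 1 <= (denv p w)%:R :> R by [rewrite ler1n]; lra.
  have [k0|/gr] := posnP (denv p z); last by apply: grows_le; lra.
  have [k1|/gr k1] := posnP (denv p (psi a).[z]); last first.
    by apply: grows_shift; apply: grows_le k1; lra.
  (* An escaping point contributes at least 2 log p; pulling back twice divides by 4, which leaves
     the required 1/2. *)
  do 2 apply: grows_shift.
  by apply: grows_le (gr _ (quadratic_denv_gt0 a0 pp r1 pa1 k0 k1)); lra.
have := @canonical_height_lower R 2 a z M c q.+1 isT a0 ad M1 aM cg.
apply: le_trans; have -> : \sum_(0 <= p < q.+1 | prime p) c p * ln p%:R
    = ln q%:R / 2 :> R.
  rewrite (ln_natE R q0 (leqnn q)) !mulr_suml; apply: eq_bigr => p _.
  by rewrite /c; ring.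
have : 0 <= ln (Num.max 1 `|ratr z : R|) by rewrite ln_ge0 // le_max lexx.
have -> : 2 * 2%:R * M = 4 * M by rewrite -natrM.
by lra.
Qed.

(* All thresholds are powers of N, written on the logarithmic scale. The value
   x = 0 is allowed in the last condition, as ln 0 = 0. *)
Definition generic (R : realType) (d : nat) (N : nat) (de : R)
    (a : d.-tuple int) : Prop :=
  [/\ (coef_height a <= N)%N,
      [/\ (1 - de) * ln N%:R <= ln `|(a`_0)%R|%:R,
          (1 - de) * ln N%:R <= ln `|(a`_(d.-1))%R|%:R
        & ln (gcdn `|(a`_0)%R| `|(a`_(d.-1))%R|)%:R <= de * ln N%:R],
      (forall m : nat, (m ^ 2 %| `|(a`_0)%R|)%N -> ln m%:R <= de * ln N%:R)
      /\ (forall m : nat, (m ^ 2 %| `|(a`_(d.-1))%R|)%N ->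
            ln m%:R <= de * ln N%:R),
      (2 < d)%N -> forall m : nat, (m %| `|(a`_0)%R|)%N ->
        (m %| `|psi_cof a 1 1|)%N -> ln m%:R <= de * ln N%:R
    & (2 < d)%N -> forall (m : nat) (x y : int),
        ln `|x|%:R <= ln N%:R / 3 :> R -> ln `|y|%:R <= ln N%:R / 3 :> R ->
        y != 0 -> coprime m `|y| -> (m %| `|(a`_0)%R|)%N ->
        (m %| `|psi_cof a x y|)%N -> ln m%:R <= (2 / 3 + de) * ln N%:R].

(** Every coefficient is at most N, while a_d is at least N^(1 - de): the constant M of the
    archimedean bounds can be N^de. *)
Lemma generic_coef_le (R : realType) (d N : nat) (de : R) (a : d.-tuple int) :
  (2 <= d)%N -> a`_(d.-1) != 0 -> generic N de a ->
  forall i, (i < d)%N ->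
    `|(a`_i)%:~R| <= expR (de * ln N%:R) * `|(a`_(d.-1))%:~R| :> R.
Proof.
move=> d2 ad [HN [_ hd _] _ _ _] i id.
rewrite -!intr_norm -!natr_absz; set A := `|(a`_(d.-1))%R|%N in hd *.
have A0 : 0 < A%:R :> R by rewrite ltr0n absz_gt0.
have AN : (A <= N)%N by apply: leq_trans HN; apply: coef_height_ge;
  rewrite prednK // ltnW.
have N0 : 0 < N%:R :> R by rewrite ltr0n (leq_trans _ AN) // absz_gt0.
apply: (@le_trans _ _ N%:R).
  by rewrite ler_nat (leq_trans _ HN) // coef_height_ge.
rewrite -[X in X <= _](lnK (x := N%:R)) ?posrE //.
rewrite -[X in _ * X](lnK (x := A%:R)) ?posrE //.
by rewrite -expRD ler_expR; lra.
Qed.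

Lemma generic_canonical_height_ge (R : realType) (d N : nat) (de : R)
    (a : d.-tuple int) (z : rat) :
  (2 <= d)%N -> a`_0 != 0 -> a`_(d.-1) != 0 -> 0 < de ->
  ln (2 * d%:R) <= de * ln N%:R -> generic N de a ->
  ((d%:R * (d%:R - 1))^-1 - 6 * de) * ln N%:R
  <= canonical_height R d (psi a) z.
Proof.
move=> d2 a0 ad de0 dN ga; have aM := generic_coef_le d2 ad ga.
case: ga => HN [h0 hd hg] [sq0 sqd] h11 hxy.
set L := ln N%:R in dN aM h0 hd hg sq0 sqd h11 hxy *.
have L0 : 0 <= L by exact: ln_nat_ge0.
set M := expR (de * L) in aM.
have M1 : 1 <= M by rewrite -expR0 ler_expR mulr_ge0 // ltW.
have d2r : 2 <= d%:R :> R by rewrite ler_nat.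
have lnM0 : ln (2 * d%:R * M) <= 2 * de * L.
  by rewrite lnM ?posrE ?expR_gt0 ?expRK //; nra.
set n0 := `|(a`_0)%R|%N in h0 hg sq0 h11 hxy.
set A0 := `|(a`_(d.-1))%R|%N in hd hg sqd.
have n00 : (0 < n0)%N by rewrite absz_gt0.
have A00 : (0 < A0)%N by rewrite absz_gt0.
have [q [m [q0 qn mn nle qp]]] := squarefree_unit_part n00 A00.
(* Of the five [de], one comes from the size of a_0, three from m^3 and one from the gcd of a_0 and
   a_d. *)
have lnq : (1 - 5 * de) * L <= ln q%:R.
  have m0 : (0 < m)%N by case: (m) mn n00 => //; rewrite dvd0n => /eqP->.
  have g0 : (0 < gcdn n0 A0)%N by rewrite gcdn_gt0 n00.
  have := sq0 m mn.
  have : ln n0%:R <= ln (q * m ^ 3 * gcdn n0 A0)%:R :> R.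
    by rewrite ler_ln ?posrE ?ltr0n ?muln_gt0 ?expn_gt0 ?q0 ?m0 ?g0 // ler_nat.
  rewrite natrM lnM ?posrE ?ltr0n ?muln_gt0 ?expn_gt0 ?q0 ?m0 //.
  rewrite natrM lnM ?posrE ?ltr0n ?expn_gt0 ?m0 //.
  by rewrite natrX lnXn ?ltr0n // -(mulr_natl (ln _)); lra.
have [d3|] := leqP 3 d; last first.
  move=> d3; have dE : d = 2%N.
    by apply/eqP; rewrite eqn_leq d2 andbT -ltnS.
  subst d; have := @canonical_height_lower_eq2 R a z M q a0 ad M1 aM q0 qn qp.
  apply: le_trans; have <- : 2 * 2%:R * M = 4 * M by rewrite -natrM.
  have -> : (2%:R * (2%:R - 1))^-1 = 2^-1 :> R by congr (_^-1); ring.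
  by have : 0 <= de * L by [rewrite mulr_ge0 // ltW]; nra.
(* With a_d = me^2 t up to sign and t squarefree, me^2 can serve as the number [e] of
   [canonical_height_lower_ge3]. *)
have [me [t [AE tsf]]] := squarefree_factor A00.
have me0 : (0 < me)%N.
  by move: A00; rewrite AE muln_gt0 expn_gt0 orbF => /andP[].
have me20 : (0 < me ^ 2)%N by rewrite expn_gt0 me0.
have ep p : (logn p A0 <= (logn p (me ^ 2)).+1)%N.
  rewrite AE lognM //; last by move: A00; rewrite AE muln_gt0 => /andP[].
  by rewrite -[leqRHS]addn1 leq_add2l.
have lne : ln (me ^ 2)%:R / 2 <= de * L.
  rewrite natrX lnXn ?ltr0n // -(mulr_natl (ln _)).
  by have := sqd me; rewrite {1}AE dvdn_mulr // => /(_ isT); lra.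
have HL w := @canonical_height_lower_ge3 R d a w M q (me ^ 2) d3 a0 ad M1 aM
  q0 qn qp me20 ep.
have d3r : 3 <= d%:R :> R by rewrite ler_nat.
have d1E : d.-1%:R = d%:R - 1 :> R.
  by rewrite -[in RHS](prednK (ltnW d2)) -natr1 addrK.
have d31 : 2 <= d%:R - 1 :> R by lra.
have d10 : 0 < d%:R - 1 :> R by exact: lt_le_trans d31.
have d0 : 0 < d%:R :> R by exact: lt_le_trans d2r.
set s : R := (d%:R - 1)^-1.
have s0 : 0 < s by rewrite invr_gt0.
have s2 : s <= 2^-1 by rewrite lef_pV2 ?posrE.
have s1 : s * (d%:R - 1) = 1 by rewrite mulVf // gt_eqF.
have -> : (d%:R * (d%:R - 1))^-1 = s / d%:R by rewrite invfM mulrC.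
set t0 := d%:R^-1; have t1 : t0 * d%:R = 1 by rewrite mulVf // gt_eqF.
have t00 : 0 < t0 by rewrite invr_gt0.
have tt : t0 <= 3^-1 by rewrite lef_pV2 ?posrE.
have qsf p : (logn p q <= 1)%N.
  by apply: (logn_dvd1 n00 qn) => pp pq; have [] := qp p pp pq.
pose A w := gcdn q (`|denq w| * `|denq (psi a).[w]|).
pose B w := (q %/ A w)%N.
have AB w : (A w * B w)%N = q by rewrite mulnC divnK // dvdn_gcdl.
have AB0 w : (0 < A w)%N && (0 < B w)%N by rewrite -muln_gt0 AB.
have lnAB w : ln (A w)%:R + ln (B w)%:R = ln q%:R :> R.
  by have /andP[? ?] := AB0 w; rewrite -lnM ?posrE ?ltr0n // -natrM AB.
have Bn w : (B w %| n0)%N.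
  by apply: dvdn_trans qn; rewrite -(AB w) dvdn_mull.
have cop w : coprime (B w) `|denq w| /\ coprime (B w) `|denq (psi a).[w]|.
  have := coprime_divn_gcdn (`|denq w| * `|denq (psi a).[w]|) q0 qsf.
  by rewrite coprimeMr => /andP[].
have Bdvd w := @psi_cof_dvd d a w (B w) d2 a0 (Bn w) (proj2 (cop w)).
have deL : 0 <= de * L by rewrite mulr_ge0 // ltW.
(* For z = 0 the divisibility of x Q is void. Its image 1 is used instead: there B divides Q(1, 1),
   so B is at most N^de and A carries almost all of q. *)
have [zE|z0] := eqVneq z 0.
  rewrite zE -(ler_pM2l d0).
  rewrite -canonical_height_psi // psi_horner0 //.
  apply: le_trans (HL 1); rewrite d1E -/s weil_height1 -/(A 1).
  have B1 : (B 1%R %| `|psi_cof a 1 1|)%N by have := Bdvd 1; rewrite mul1n.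
  have lnB := h11 d3 (B 1) (Bn 1) B1; have lnA := lnAB 1.
  have hA : (1 - 6 * de) * L <= ln (A 1)%:R by lra.
  have -> : d%:R * ((s * t0 - 6 * de) * L) = (t0 * d%:R) * s * L - 6 * d%:R * (de * L).
    by ring.
  have hs : (1 - 6 * de) * L * s <= ln (A 1)%:R * s by rewrite ler_wpM2r // ltW.
  have := ler_wpM2r deL s2; have := ler_wpM2r deL d3r.
  by rewrite t1; lra.
rewrite leNgt; apply/negP => small.
have := HL z; rewrite d1E -/s -/(A z); set hz := weil_height R z => Hz.
have lA0 : 0 <= ln (A z)%:R :> R by exact: ln_nat_ge0.
have key : ln (A z)%:R * s + hz / 2 < s * t0 * L - 3 * de * L by lra.
have hz0 : 0 <= hz by exact: weil_height_ge0.
(* Multiply [key] by d - 1, which is at least 2: this clears the 1/2 before the height and doubles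
   the error 3 [de]. *)
have key2 : ln (A z)%:R + hz < t0 * L - 6 * de * L.
  have : (ln (A z)%:R * s + hz / 2) * (d%:R - 1)
       < (s * t0 * L - 3 * de * L) * (d%:R - 1) by rewrite ltr_pM2r //; lra.
  have -> : (ln (A z)%:R * s + hz / 2) * (d%:R - 1)
    = ln (A z)%:R * (s * (d%:R - 1)) + hz * (d%:R - 1) / 2 by ring.
  have -> : (s * t0 * L - 3 * de * L) * (d%:R - 1)
    = (s * (d%:R - 1)) * t0 * L - 3 * (de * L) * (d%:R - 1) by ring.
  by rewrite s1; nra.
have tL : t0 * L <= 3^-1 * L by rewrite ler_wpM2r.
have hzL : hz <= L / 3 by lra.
have lx : ln `|numq z|%:R <= hz.
  rewrite /hz /weil_height ler_ln ?posrE ?ltr0n ?absz_gt0 ?numq_eq0 //.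
    by rewrite ler_nat leq_maxl.
  by rewrite leq_max absz_denq_gt0 orbT.
have ly : ln `|denq z|%:R <= hz.
  rewrite /hz /weil_height ler_ln ?posrE ?ltr0n ?absz_denq_gt0 //.
    by rewrite ler_nat leq_maxr.
  by rewrite leq_max absz_denq_gt0 orbT.
(* From B | x Q the factor of B prime to x/g passes to Q: b = B/g divides Q, while g divides x and
   so has logarithm at most h(z). *)
pose g := gcdn (B z) `|numq z|; pose b := (B z %/ g)%N.
have x0 : (0 < `|numq z|)%N by rewrite absz_gt0 numq_eq0.
have B0 : (0 < B z)%N by have /andP[] := AB0 z.
have g0 : (0 < g)%N by rewrite gcdn_gt0 B0.
have bg : (b * g)%N = B z by rewrite divnK // dvdn_gcdl.
have b0 : (0 < b)%N by move: B0; rewrite -bg muln_gt0 => /andP[].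
have bB : (b %| B z)%N by rewrite -bg dvdn_mulr.
have bcof : (b %| `|psi_cof a (numq z) (denq z)|)%N.
  have xE : (`|numq z| %/ g * g)%N = `|numq z|%N by rewrite divnK // dvdn_gcdr.
  have := Bdvd z; rewrite -{1}bg -xE mulnAC dvdn_pmul2r // Gauss_dvdr //.
  by rewrite /coprime -(eqn_pmul2r g0) mul1n muln_gcdl bg xE.
have lnb : ln b%:R <= (2 / 3 + de) * L.
  apply: (hxy d3 b (numq z) (denq z)) => //.
  - exact: le_trans lx hzL.
  - exact: le_trans ly hzL.
  - exact: coprime_dvdl bB (proj1 (cop z)).
  - exact: dvdn_trans bB (Bn z).
have lng : ln g%:R <= hz.
  apply: le_trans lx; rewrite ler_ln ?posrE ?ltr0n // ler_nat.
  by apply: dvdn_leq => //; exact: dvdn_gcdr.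
(* Contradiction: ln A + h(z) < (1/3 - 6 de) L and ln b <= (2/3 + de) L add up to ln q < (1 - 5 de)
   L. *)
have : ln b%:R + ln g%:R = ln (B z)%:R :> R.
  by rewrite -lnM ?posrE ?ltr0n // -natrM bg.
have := lnAB z.
by lra.
Qed.

(** The point 0 bounds lambda_1 from above, the uniform lower bound does so from below. Passing from
    log N to the logarithm of the height costs at most a factor 2, as de <= 1/2; hence 12 instead of
    6. *)
Lemma generic_lambda1 (R : realType) (d N : nat) (de eps : R)
    (a : d.-tuple int) :
  (2 <= d)%N -> a`_0 != 0 -> a`_(d.-1) != 0 -> 0 < de -> de <= 2^-1 ->
  12 * de <= eps -> 6 * de < (d%:R * (d%:R - 1))^-1 ->
  0 < ln N%:R :> R -> ln (2 * d%:R) <= de * ln N%:R -> generic N de a ->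
  `| lambda1 R d (psi a) - ln (coef_height a)%:R / (d%:R * (d%:R - 1)) |
  <= eps * ln (coef_height a)%:R.
Proof.
move=> d2 a0 ad de0 de2 de12 de6 L0 dN ga.
have low z := generic_canonical_height_ge z d2 a0 ad de0 dN ga.
have d2r : 2 <= d%:R :> R by rewrite ler_nat.
have H1 : (0 < coef_height a)%N.
  by apply: leq_trans (coef_height_ge a (ltnW d2)); rewrite absz_gt0.
have HN : ln (coef_height a)%:R <= ln N%:R :> R.
  have [HN _ _ _ _] := ga; rewrite ler_ln ?posrE ?ltr0n ?ler_nat //.
  exact: leq_trans HN.
have HL : (1 - de) * ln N%:R <= ln (coef_height a)%:R.
  have [_ [h0 _ _] _ _ _] := ga; apply: le_trans h0 _.
  by rewrite ler_ln ?posrE ?ltr0n ?ler_nat ?coef_height_ge ?absz_gt0 // ltnW.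
(* The lower bound makes the canonical height of 0 positive. *)
have nP : ~ Prep (psi a) 0.
  move=> /(canonical_height_Prep R d2 a0); apply/negP; rewrite -ltNge.
  by apply: lt_le_trans (low 0); rewrite mulr_gt0 // subr_gt0.
have [z zE zle] := lambda1_attained R d2 a0 ad nP.
have up := le_trans zle (canonical_height0_le R d2 a0).
have lo := low z; rewrite -zE in lo; set l := lambda1 _ _ _ in lo up *.
set H := ln (coef_height a)%:R in HN HL *; set L := ln N%:R in L0 dN HN HL lo *.
have H0 : 0 <= H by exact: ln_nat_ge0.
have dd : 0 < d%:R * (d%:R - 1) :> R by nra.
rewrite natrM lnM ?posrE ?ltr0n // in up; last exact: ltnW.
rewrite -/H mulrDl in up; set K := (d%:R * (d%:R - 1))^-1 in de6 lo up *.
have K0 : 0 < K by rewrite invr_gt0.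
have K1 : K <= 2^-1 by rewrite lef_pV2 ?posrE; nra.
have lnd : ln d%:R <= de * L.
  apply: le_trans dN; rewrite ler_ln ?posrE; lra.
have lnd0 : 0 <= ln d%:R :> R by exact: ln_nat_ge0.
rewrite ler_norml; apply/andP; split.
  have h1 : H * K <= L * K by rewrite ler_wpM2r // ltW.
  have h2 : eps * ((1 - de) * L) <= eps * H by rewrite ler_wpM2l //; lra.
  have h3 : 12 * de * ((1 - de) * L) <= eps * ((1 - de) * L).
    by rewrite ler_wpM2r // mulr_ge0 //; lra.
  have h4 : 0 <= de * L * (2^-1 - de).
    by rewrite !mulr_ge0 //; lra.
  by lra.
have h1 : ln d%:R * K <= ln d%:R * 2^-1 by rewrite ler_wpM2l.
have h2 : L <= 2 * H by have : 0 <= L * (2^-1 - de)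
  by [rewrite mulr_ge0 //; lra]; lra.
have h3 : de * L <= de * (2 * H) by rewrite ler_wpM2l // ltW.
have h4 : 12 * de * H <= eps * H by rewrite ler_wpM2r.
by have : 0 <= de * H by [rewrite mulr_ge0 // ltW]; lra.
Qed.

(** * Counting exceptional coefficients *)

(** Double counting along the involution (t, u) -> (upd t u, get t): the density of P is the average
    of its densities on the fibers. *)
Lemma card_fibers (T U : finType) (get : T -> U) (upd : T -> U -> T)
    (P : pred T) :
  (forall t u, get (upd t u) = u) ->
  (forall t u u', upd (upd t u) u' = upd t u') ->
  (forall t, upd t (get t) = t) ->
  (#|U| * #|P| = \sum_t #|[pred u | P (upd t u)]|)%N.
Proof.
move=> gu uu ug.
have -> : (#|U| * #|P| = \sum_(x : T * U) P x.1)%N.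
  rewrite -(pair_bigA _ (fun t (_ : U) => nat_of_bool (P t))) /=.
  under eq_bigr do rewrite sum_nat_const.
  rewrite -big_distrr /=; congr (_ * _)%N.
  rewrite -sum1_card big_mkcond; apply: eq_bigr => t _.
  by rewrite -[t \in P]/(P t); case: (P t).
pose s (x : T * U) := (upd x.1 x.2, get x.1).
have sK : involutive s by move=> [t u]; rewrite /s /= gu uu ug.
rewrite (reindex s); last by exists s => x _; exact: sK.
rewrite -(pair_bigA _ (fun t u => nat_of_bool (P (upd t u)))) /=.
apply: eq_bigr => t _; rewrite -sum1_card [RHS]big_mkcond;
  apply: eq_bigr => u _.
by rewrite inE; case: (P _).
Qed.

Definition upd2 (d K : nat) (i j : 'I_d) (f : {ffun 'I_d -> 'I_K})
    (u : 'I_K * 'I_K) : {ffun 'I_d -> 'I_K} :=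
  [ffun k => if k == i then u.1 else if k == j then u.2 else f k].

Lemma card_fibers2 (d K : nat) (i j : 'I_d) (P : pred {ffun 'I_d -> 'I_K}) :
  i != j ->
  (K ^ 2 * #|P| = \sum_f #|[pred u | P (upd2 i j f u)]|)%N.
Proof.
move=> ij; have <- : #|{: 'I_K * 'I_K}| = (K ^ 2)%N.
  by rewrite card_prod card_ord expnS expn1.
apply: (card_fibers (get := fun f : {ffun 'I_d -> 'I_K} => (f i, f j))).
- by move=> f [u v]; rewrite /upd2 !ffunE eqxx eq_sym (negbTE ij) eqxx.
- move=> f u v; apply/ffunP => k; rewrite !ffunE.
  by case: eqP => // _; case: eqP.
- move=> f; apply/ffunP => k; rewrite !ffunE /=.
  by case: eqP => [->//|_]; case: eqP => [->|].
Qed.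

(** * Union bounds and residue classes *)

Lemma card_exists_le (T I : finType) (Q : pred I) (P : I -> pred T) :
  (#|[pred t | [exists i, Q i && P i t]]| <= \sum_(i | Q i) #|P i|)%N.
Proof.
rewrite -sum1_card big_mkcond /=.
under [leqRHS]eq_bigr do rewrite -sum1_card big_mkcond /=.
rewrite exchange_big /=; apply: leq_sum => t _; rewrite inE.
case: ifP => // /existsP[i /andP[Qi Pi]].
by rewrite (bigD1 i) //= -[t \in P i]/(P i t) Pi.
Qed.

(** Inside one residue class the quotient by m determines the element. *)
Lemma card_congr2 (K m : nat) (P : pred ('I_K * 'I_K)) :
  (0 < m)%N ->
  (forall u v, P u -> P v -> u.1 = v.1 %[mod m] /\ u.2 = v.2 %[mod m]) ->
  (#|P| <= (K %/ m).+1 ^ 2)%N.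
Proof.
move=> m0 H; have lt (u : 'I_K) : (u %/ m < (K %/ m).+1)%N.
  by rewrite ltnS leq_div2r // ltnW.
pose s (u : 'I_K * 'I_K) := (Ordinal (lt u.1), Ordinal (lt u.2)).
have -> : ((K %/ m).+1 ^ 2 = #|{: 'I_(K %/ m).+1 * 'I_(K %/ m).+1}|)%N.
  by rewrite card_prod card_ord expnS expn1.
rewrite -(card_in_image (f := s) (A := P)); first exact: max_card.
move=> [u1 u2] [v1 v2] Pu Pv [e1 e2]; have [/= c1 c2] := H _ _ Pu Pv.
congr (_, _); apply: val_inj => /=.
  by rewrite (divn_eq u1 m) e1 c1 -divn_eq.
by rewrite (divn_eq u2 m) e2 c2 -divn_eq.
Qed.

Lemma card_congr1 (K m : nat) (P : pred 'I_K) :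
  (0 < m)%N -> (forall u v, P u -> P v -> u = v %[mod m]) ->
  (#|P| <= (K %/ m).+1)%N.
Proof.
move=> m0 H; have lt (u : 'I_K) : (u %/ m < (K %/ m).+1)%N.
  by rewrite ltnS leq_div2r // ltnW.
rewrite -[leqRHS]card_ord.
rewrite -(card_in_image (f := fun u => Ordinal (lt u)) (A := P));
  first exact: max_card.
move=> u v Pu Pv [e]; apply: val_inj => /=.
by rewrite (divn_eq u m) e (H _ _ Pu Pv) -divn_eq.
Qed.

Lemma card_fst (K : nat) (P : pred 'I_K) :
  #|[pred u : 'I_K * 'I_K | P u.1]| = (#|P| * K)%N.
Proof.
rewrite -[X in (_ * X)%N]card_ord -cardX; apply: eq_card => -[u v].
by rewrite !inE andbT.
Qed.

Lemma sum_inv_sqr_le (R : realType) (N : nat) (M : R) : 0 < M ->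
  \sum_(m < N.+1 | M < m%:R) (m%:R ^+ 2)^-1 <= 2 / M.
Proof.
move=> M0; pose b := (Num.trunc M).+1.
have bM : M < b%:R by exact: truncnS_gt.
(* Telescoping with 1/n^2 <= 1/(n - 1) - 1/n, the first term being bounded by 1/b. The subtracted
   inverse of the last index makes the induction go through. *)
have tail n : \sum_(0 <= m < n | (b <= m)%N) (m%:R ^+ 2)^-1
    <= (if (b < n)%N then 2 / b%:R - (n.-1%:R)^-1 else 0) :> R.
  elim: n => [|n IHn]; first by rewrite big_geq.
  rewrite big_mkcond big_nat_recr //= -big_mkcond /=.
  rewrite ltnS; case: ifP => bn; last first.
    by rewrite addr0; apply: le_trans IHn _; rewrite ltnNge ltnW // ltnNge bn.
  have n0 : 0 < n%:R :> R by rewrite ltr0n (leq_trans _ bn).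
  have [nb|bn'] := leqP n b.
    have nE : n = b by apply/eqP; rewrite eqn_leq nb bn.
    rewrite nE ltnn in IHn *; move: IHn;
      set S := \sum_(_ <= _ < _ | _) _ => IHn.
    have b1 : 1 <= b%:R :> R by rewrite ler1n.
    have : (b%:R ^+ 2)^-1 <= b%:R^-1 :> R.
      rewrite lef_pV2 ?posrE ?exprn_gt0 ?ltr0n //; by rewrite expr2 ler_peMl.
    by lra.
  rewrite bn' in IHn; move: IHn; set S := \sum_(_ <= _ < _ | _) _ => IHn.
  have n1 : 0 < n.-1%:R :> R by rewrite ltr0n; lia.
  have nE : n%:R = n.-1%:R + 1 :> R by rewrite natr1 prednK //; lia.
  suff : (n%:R ^+ 2)^-1 <= n.-1%:R^-1 - n%:R^-1 :> R by lra.
  have -> : n.-1%:R^-1 - n%:R^-1 = (n.-1%:R * n%:R)^-1 :> R.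
    by rewrite nE; field; apply/andP; split; lra.
  by rewrite lef_pV2 ?posrE ?mulr_gt0 ?exprn_gt0 // nE; nra.
have -> : \sum_(m < N.+1 | M < m%:R) (m%:R ^+ 2)^-1
    = \sum_(0 <= m < N.+1 | (b <= m)%N) (m%:R ^+ 2)^-1 :> R.
  rewrite big_mkord; apply: eq_bigl => m.
  by rewrite /b truncn_lt_nat // ltW.
apply: le_trans (tail _) _.
have h : 2 / b%:R <= 2 / M :> R.
  by rewrite ler_pM2l // lef_pV2 ?posrE ?ltW // ltr0n.
case: ifP => _; last by rewrite divr_ge0 // ltW.
by apply: le_trans h; rewrite gerBl invr_ge0.
Qed.

(** Each modulus m has proportion O(1/m^2), and the tail of this series beyond M is at most 2/M. *)
Lemma union_congr_le (R : realType) (N : nat) (T : finType) (M : R)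
    (P : nat -> pred T) :
  (0 < N)%N -> 0 < M ->
  (forall m, (0 < m <= N)%N -> M < m%:R ->
     #|P m|%:R <= 16 * N%:R ^+ 2 / m%:R ^+ 2 :> R) ->
  #|[pred t | [exists m : 'I_N.+1, (M < m%:R) && P m t]]|%:R
  <= 32 * N%:R ^+ 2 / M :> R.
Proof.
move=> N0 M0 H.
apply: (@le_trans _ _ (\sum_(m < N.+1 | M < m%:R) #|P m|%:R)).
  rewrite -natr_sum ler_nat.
  exact: (card_exists_le (fun m : 'I_N.+1 => M < m%:R) (fun m : 'I_N.+1 => P m)).
apply: (@le_trans _ _ (\sum_(m < N.+1 | M < m%:R)
    16 * N%:R ^+ 2 * (m%:R ^+ 2)^-1)).
  apply: ler_sum => m Mm; apply: H => //.
  rewrite -(ltnS m) ltn_ord andbT lt0n; apply: contraTneq Mm => ->.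
  by rewrite -leNgt ltW.
rewrite -mulr_sumr;
  have := ler_wpM2l (x := 16 * N%:R ^+ 2) _ (sum_inv_sqr_le N M0).
have N2 : 0 <= 16 * N%:R ^+ 2 :> R by rewrite mulr_ge0 // exprn_ge0.
move=> /(_ N2) /le_trans; apply; rewrite le_eqVlt; apply/orP; left; apply/eqP.
by ring.
Qed.

Lemma divn_succ_le (R : realType) (N m : nat) : (0 < m <= N)%N ->
  ((2 * N).+1 %/ m).+1%:R <= 4 * N%:R / m%:R :> R.
Proof.
move=> /andP[m0 mN]; have m0r : 0 < m%:R :> R by rewrite ltr0n.
rewrite ler_pdivlMr // -!natrM ler_nat mulSn.
by have := leq_trunc_div (2 * N).+1 m; lia.
Qed.

Lemma card_congr2_le (R : realType) (N m : nat)
    (P : pred ('I_(2 * N).+1 * 'I_(2 * N).+1)) :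
  (0 < m <= N)%N ->
  (forall u v, P u -> P v -> u.1 = v.1 %[mod m] /\ u.2 = v.2 %[mod m]) ->
  #|P|%:R <= 16 * N%:R ^+ 2 / m%:R ^+ 2 :> R.
Proof.
move=> mN H; have /andP[m0 _] := mN.
apply: (@le_trans _ _ ((4 * N%:R / m%:R) ^+ 2)); last first.
  by rewrite le_eqVlt -exprVn; apply/orP; left; apply/eqP; ring.
apply: (@le_trans _ _ (((2 * N).+1 %/ m).+1%:R ^+ 2)).
  by rewrite -natrX ler_nat card_congr2.
by rewrite lerXn2r ?nnegrE ?divr_ge0 ?mulr_ge0 // divn_succ_le.
Qed.

Lemma card_congr1_le (R : realType) (N m : nat) (P : pred 'I_(2 * N).+1) :
  (0 < N)%N -> (0 < m)%N -> (m ^ 2 <= N)%N ->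
  (forall u v, P u -> P v -> u = v %[mod m ^ 2]) ->
  (#|P| * (2 * N).+1)%:R <= 16 * N%:R ^+ 2 / m%:R ^+ 2 :> R.
Proof.
move=> N0 m0 mN H; have m20 : (0 < m ^ 2)%N by rewrite expn_gt0 m0.
have h1 : #|P|%:R <= 4 * N%:R / (m ^ 2)%:R :> R.
  apply: le_trans (divn_succ_le R _); last by rewrite m20 mN.
  by rewrite ler_nat card_congr1.
have h2 : (2 * N).+1%:R <= 4 * N%:R :> R.
  by rewrite -natrM ler_nat; lia.
rewrite natrM; apply: (@le_trans _ _ (4 * N%:R / (m ^ 2)%:R * (4 * N%:R))).
  by rewrite ler_pM.
by rewrite natrX le_eqVlt; apply/orP; left; apply/eqP; ring.
Qed.

(** * Rare events in the box of coefficient vectors with entries in [-N, N] *)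

Definition box_val (N : nat) (u : 'I_(2 * N).+1) : int := u%:Z - N%:Z.

Definition box_vec (d N : nat) (f : {ffun 'I_d -> 'I_(2 * N).+1}) :
  d.-tuple int := [tuple box_val (f i) | i < d].

Lemma box_valP (N : nat) (u : 'I_(2 * N).+1) : (`|box_val u| <= N)%N.
Proof. by rewrite /box_val; have := ltn_ord u; lia. Qed.

Lemma box_vecE (d N : nat) (f : {ffun 'I_d -> 'I_(2 * N).+1}) (i : 'I_d) :
  (box_vec f)`_i = box_val (f i).
Proof. by rewrite -tnth_nth tnth_mktuple. Qed.

Lemma box_val_congr (N m : nat) (u v : 'I_(2 * N).+1) :
  (m %| `|(box_val u - box_val v)%R|)%N -> u = v %[mod m].
Proof.
have -> : box_val u - box_val v = u%:Z - v%:Z by rewrite /box_val; ring.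
move=> H; have : (u%:Z = v%:Z %[mod m])%Z by apply/eqP;
  rewrite eqz_mod_dvd dvdzE.
by rewrite !modz_nat => -[].
Qed.

Lemma box_val_congr0 (N m : nat) (u v : 'I_(2 * N).+1) :
  (m %| `|box_val u|)%N -> (m %| `|box_val v|)%N -> u = v %[mod m].
Proof.
move=> mu mv; apply: box_val_congr.
have : (m%:Z %| box_val u - box_val v)%Z by rewrite rpredB // dvdzE.
by rewrite dvdzE.
Qed.

Lemma box_val_surj (N : nat) (c : int) : (`|c| <= N)%N ->
  exists u : 'I_(2 * N).+1, box_val u = c.
Proof.
move=> cN; have lt : (`|(c + N%:Z)%R| < (2 * N).+1)%N by lia.
by exists (Ordinal lt); rewrite /box_val /=; lia.
Qed.

(** In Q the coefficient a_1 occurs only in the term a_1 y^(d - 1), and d > 2 keeps it distinct from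
    the leading coefficient. Divisibility of Q by m prime to y thus fixes a_1 modulo m. *)
Lemma psi_cof_sub (d : nat) (a b : d.-tuple int) (x y : int) :
  (2 < d)%N -> (forall i, (2 <= i < d)%N -> a`_i = b`_i) ->
  psi_cof a x y - psi_cof b x y = (a`_1 - b`_1) * y ^+ d.-1.
Proof.
move=> d3 ab; have d1 : (1 < d.-1)%N by lia.
have split1 (c : d.-tuple int) : psi_cof c x y
    = c`_(d.-1) * x ^+ d.-1 + (c`_1 * y ^+ d.-1
      + \sum_(2 <= i < d.-1) c`_i * x ^+ i.-1 * y ^+ (d - i)).
  by rewrite /psi_cof (big_ltn d1) expr0 mulr1 subn1.
have dd : (d.-1 < d)%N by lia.
rewrite !split1 (ab d.-1) ?d1 ?dd //.
rewrite (@eq_big_nat _ _ _ 2 d.-1 _ (fun i => b`_i * x ^+ i.-1 * y ^+ (d - i))).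
  by ring.
by move=> i /andP[i2 i1]; rewrite ab // i2 (ltn_trans i1).
Qed.

Lemma rare_fibers (R : realType) (d N : nat) (i j : 'I_d)
    (P : pred {ffun 'I_d -> 'I_(2 * N).+1}) (c : R) :
  i != j -> 0 <= c ->
  (forall f, #|[pred u | P (upd2 i j f u)]|%:R <= N%:R ^+ 2 * c) ->
  #|P|%:R <= #|{: {ffun 'I_d -> 'I_(2 * N).+1}}|%:R * c.
Proof.
move=> ij c0 H;
  have K0 : 0 < ((2 * N).+1 ^ 2)%:R :> R by rewrite ltr0n expn_gt0.
rewrite -(ler_pM2l K0) -natrM (card_fibers2 P ij) natr_sum.
apply: le_trans (ler_sum _ (fun f _ => H f)) _.
rewrite sumr_const -(mulr_natl (_ * c)) [leRHS]mulrCA ler_wpM2l ?ler0n //.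
by rewrite ler_wpM2r // -natrX ler_nat; apply: expn_leq2r; lia.
Qed.

Lemma box_small_le (N r : nat) :
  (#|[pred u : 'I_(2 * N).+1 | (`|box_val u| <= r)%N]| <= (2 * r).+1)%N.
Proof.
rewrite -[leqRHS]card_ord; set P := [pred u | _].
rewrite -(card_in_image (f := fun u : 'I_(2 * N).+1 =>
    inord (u + r - N) : 'I_(2 * r).+1) (A := P)); first exact: max_card.
move=> u v; rewrite !inE /box_val => uP vP /(congr1 val) /=.
by rewrite !inordK; try lia; move=> ?; apply: val_inj => /=; lia.
Qed.

Lemma box_small_rare (R : realType) (N : nat) (s : R) : (0 < N)%N -> 1 <= s ->
  (#|[pred u : 'I_(2 * N).+1 | (`|box_val u|%N%:R <= s)]| * (2 * N).+1)%:R
  <= N%:R * (12 * s) :> R.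
Proof.
move=> N0 s1; have s0 : 0 <= s by apply: le_trans s1.
have h1 : #|[pred u : 'I_(2 * N).+1 | `|box_val u|%N%:R <= s]|%:R <= 3 * s.
  apply: (@le_trans _ _ (2 * Num.trunc s).+1%:R).
    rewrite ler_nat; apply: leq_trans (box_small_le N (Num.trunc s)).
    apply: eq_leq; apply: eq_card => u; rewrite !inE.
    by rewrite truncn_ge_nat.
  have := truncn_le s; rewrite s0 -natr1 natrM; lra.
have h2 : (2 * N).+1%:R <= 4 * N%:R :> R by rewrite -natrM ler_nat; lia.
rewrite natrM; apply: (@le_trans _ _ (3 * s * (4 * N%:R))).
  by rewrite ler_pM.
by rewrite le_eqVlt; apply/orP; left; apply/eqP; ring.
Qed.

(** For m^2 <= N count multiples of m^2; for larger m no nonzero entry qualifies. The second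
    coordinate is free, so that the union bound for pairs applies. *)
Lemma sqr_divisor_rare (R : realType) (N : nat) (M : R) : (0 < N)%N -> 0 < M ->
  #|[pred u : 'I_(2 * N).+1 * 'I_(2 * N).+1 | [exists m : 'I_N.+1,
      (M < m%:R) && ((box_val u.1 != 0) && (m ^ 2 %| `|box_val u.1|)%N)]]|%:R
  <= 32 * N%:R ^+ 2 / M :> R.
Proof.
move=> N0 M0; apply: (union_congr_le (P := fun m => [pred u |
  (box_val u.1 != 0) && (m ^ 2 %| `|box_val u.1|)%N])) => // m /andP[m0 mN] _.
rewrite (card_fst (fun w => (box_val w != 0) && (m ^ 2 %| `|box_val w|)%N)).
have [m2N|m2N] := leqP (m ^ 2) N.
  apply: card_congr1_le => // u v /andP[_ mu] /andP[_ mv].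
  exact: box_val_congr0.
rewrite eq_card0 ?mul0n ?divr_ge0 ?mulr_ge0 ?exprn_ge0 // => u.
rewrite -topredE /=; apply/negP => /andP[u0 /dvdn_leq].
rewrite absz_gt0 => /(_ u0); apply/negP; rewrite -ltnNge.
exact: leq_ltn_trans (box_valP u) m2N.
Qed.

Lemma common_divisor_rare (R : realType) (N : nat) (M : R) :
  (0 < N)%N -> 0 < M ->
  #|[pred u : 'I_(2 * N).+1 * 'I_(2 * N).+1 | [exists m : 'I_N.+1,
      (M < m%:R)
      && ((m %| `|box_val u.1|)%N && (m %| `|box_val u.2|)%N)]]|%:R
  <= 32 * N%:R ^+ 2 / M :> R.
Proof.
move=> N0 M0; apply: (union_congr_le (P := fun m => [pred u |
  (m %| `|box_val u.1|)%N && (m %| `|box_val u.2|)%N])) => // m mN _.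
apply: card_congr2_le => // u v /andP[u1 u2] /andP[v1 v2].
by split; exact: box_val_congr0.
Qed.

(** With the other coefficients fixed, m | a_0 and m | Q(x, y) determine the pair (a_0, a_1) modulo
    m. *)
Lemma cof_divisor_rare (R : realType) (d N : nat) (i j : 'I_d) (x y : int)
    (f : {ffun 'I_d -> 'I_(2 * N).+1}) (M : R) :
  (2 < d)%N -> i = 0%N :> nat -> j = 1%N :> nat -> (0 < N)%N -> 0 < M ->
  #|[pred u : 'I_(2 * N).+1 * 'I_(2 * N).+1 | [exists m : 'I_N.+1,
      (M < m%:R)
      && [&& (m %| `|box_val u.1|)%N, coprime m `|y|
           & (m %| `|psi_cof (box_vec (upd2 i j f u)) x y|)%N]]]|%:R
  <= 32 * N%:R ^+ 2 / M :> R.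
Proof.
move=> d3 iE jE N0 M0; apply: (union_congr_le (P := fun m => [pred u |
  [&& (m %| `|box_val u.1|)%N, coprime m `|y|
    & (m %| `|psi_cof (box_vec (upd2 i j f u)) x y|)%N]])) => // m mN _.
apply: card_congr2_le => // u v /and3P[u1 my u2] /and3P[v1 _ v2].
split; first exact: box_val_congr0.
apply: box_val_congr.
have ij : j != i by rewrite -val_eqE /= iE jE.
have nj (w : 'I_(2 * N).+1 * 'I_(2 * N).+1) :
    (box_vec (upd2 i j f w))`_1 = box_val w.2.
  by have := box_vecE (upd2 i j f w) j; rewrite jE ffunE (negbTE ij) eqxx.
have : (m%:Z %| psi_cof (box_vec (upd2 i j f u)) x y
          - psi_cof (box_vec (upd2 i j f v)) x y)%Z.
  by rewrite rpredB // dvdzE.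
rewrite psi_cof_sub // => [|k /andP[k2 kd]].
  by rewrite !nj dvdzE abszM abszX Gauss_dvdl // coprimeXr.
rewrite -[k]/(nat_of_ord (Ordinal kd)) !box_vecE !ffunE.
by do 2 (rewrite -val_eqE /= ?iE ?jE; case: eqP => [?|_]; first lia).
Qed.

Lemma rare_pair (R : realType) (d N : nat) (i j : 'I_d)
    (Q : pred ('I_(2 * N).+1 * 'I_(2 * N).+1)) (c : R) :
  i != j -> 0 <= c -> #|Q|%:R <= N%:R ^+ 2 * c ->
  #|[pred f : {ffun 'I_d -> 'I_(2 * N).+1} | Q (f i, f j)]|%:R
  <= #|{: {ffun 'I_d -> 'I_(2 * N).+1}}|%:R * c.
Proof.
move=> ij c0 H; apply: (rare_fibers ij c0) => f; apply: le_trans H.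
rewrite ler_nat; apply/eq_leq/eq_card => -[u v].
rewrite !inE /= /upd2 !ffunE eqxx eq_sym (negbTE ij) eqxx.
by [].
Qed.

Lemma card_predU_le (R : realType) (T : finType) (P Q : pred T) (b c : R) :
  #|P|%:R <= b -> #|Q|%:R <= c -> #|[predU P & Q]|%:R <= b + c.
Proof.
move=> Pb Qc; apply: le_trans (lerD Pb Qc); rewrite -natrD ler_nat.
by rewrite -cardUI leq_addr.
Qed.

Lemma ln_nat_le (R : realType) (m : nat) (t : R) :
  0 <= t -> ~~ (expR t < m%:R) -> ln m%:R <= t.
Proof.
move=> t0; rewrite -leNgt; case: m => [|m]; first by rewrite ln0.
by move=> H; rewrite -[leRHS]expRK ler_ln ?posrE ?expR_gt0.
Qed.

Lemma small_root_rare (R : realType) (d N : nat) (de : R) : (2 < d)%N ->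
  (0 < N)%N -> 0 < de ->
  exists E : pred {ffun 'I_d -> 'I_(2 * N).+1},
    #|E|%:R <= #|{: {ffun 'I_d -> 'I_(2 * N).+1}}|%:R
               * (320 / expR (de * ln N%:R)) :> R
    /\ forall f, (box_vec f)`_0 != 0 -> ~~ E f ->
       (forall m : nat, (m %| `|((box_vec f)`_0)%R|)%N ->
          (m %| `|psi_cof (box_vec f) 1 1|)%N -> ln m%:R <= de * ln N%:R)
       /\ (forall (m : nat) (x y : int),
          ln `|x|%:R <= ln N%:R / 3 :> R -> ln `|y|%:R <= ln N%:R / 3 :> R ->
          y != 0 -> coprime m `|y| -> (m %| `|((box_vec f)`_0)%R|)%N ->
          (m %| `|psi_cof (box_vec f) x y|)%N ->
          ln m%:R <= (2 / 3 + de) * ln N%:R).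
Proof.
move=> d3 N0 de0; set L := ln N%:R; set M := expR (de * L).
have L0 : 0 <= L by exact: ln_nat_ge0.
have M0 : 0 < M by exact: expR_gt0.
pose i : 'I_d := Ordinal (ltn_trans (isT : 0 < 2)%N d3).
pose j : 'I_d := Ordinal (ltn_trans (isT : 1 < 2)%N d3).
have ij : i != j by [].
pose S := Num.trunc (expR (L / 3)); pose M' := expR ((2 / 3 + de) * L).
have S1 : 1 <= expR (L / 3) by rewrite -expR0 ler_expR divr_ge0.
have [SL _] : S%:R <= expR (L / 3) /\ true by rewrite truncn_le expR_ge0.
pose root_mod (x y : int) (m : nat) (f : {ffun 'I_d -> 'I_(2 * N).+1}) :=
  [&& (m %| `|box_val (f i)|)%N,
  coprime m `|y| & (m %| `|psi_cof (box_vec f) x y|)%N].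
pose E1 := [pred f | [exists m : 'I_N.+1, (M < m%:R) && root_mod 1 1 m f]].
pose E2 := [pred f | [exists w : 'I_(2 * S).+1 * 'I_(2 * S).+1, xpredT w &&
  [exists m : 'I_N.+1, (M' < m%:R)
    && root_mod (box_val w.1) (box_val w.2) m f]]].
have fib x y m f u : root_mod x y m (upd2 i j f u)
   = [&& (m %| `|box_val u.1|)%N, coprime m `|y|
           & (m %| `|psi_cof (box_vec (upd2 i j f u)) x y|)%N].
  by rewrite /root_mod ffunE eqxx.
exists [predU E1 & E2]; split.
  (* The point (1, 1) costs 32/M. There are at most 9 N^(2/3) pairs (x, y), each costing 32/M' with
     M' = N^(2/3) M; and 288 = 9 * 32. *)
  have -> : 320 / M = 32 / M + 288 / M by rewrite -mulrDl -natrD.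
  rewrite mulrDr; apply: card_predU_le; apply: (rare_fibers ij);
    rewrite ?divr_ge0 ?ler0n ?(ltW M0) // => f.
    rewrite mulrA [_ * 32]mulrC.
    apply: le_trans (@cof_divisor_rare R d N i j 1 1 f M d3 _ _ N0 M0) => //.
    rewrite ler_nat; apply/eq_leq/eq_card => u; rewrite !inE /=.
    by apply: eq_existsb => m; rewrite fib.
  pose P (w : 'I_(2 * S).+1 * 'I_(2 * S).+1) := [pred u | [exists m : 'I_N.+1,
    (M' < m%:R) && root_mod (box_val w.1) (box_val w.2) m (upd2 i j f u)]].
  apply: (@le_trans _ _ (\sum_(w | xpredT w) #|P w|%:R)).
    rewrite -natr_sum ler_nat; apply: leq_trans (card_exists_le xpredT P).
    by apply/eq_leq/eq_card => u; rewrite !inE.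
  apply: (@le_trans _ _ (\sum_(w : 'I_(2 * S).+1 * 'I_(2 * S).+1)
      (32 * N%:R ^+ 2 / M'))).
    apply: ler_sum => w _.
    apply: le_trans (@cof_divisor_rare R d N i j (box_val w.1) (box_val w.2) f
      M' d3 _ _ N0 _) => //; last exact: expR_gt0.
    rewrite ler_nat; apply/eq_leq/eq_card => u; rewrite !inE /=.
    by apply: eq_existsb => m; rewrite fib.
  rewrite sumr_const card_prod card_ord -(mulr_natl (_ / M')) natrM.
  have S3 : (2 * S).+1%:R <= 3 * expR (L / 3).
    by rewrite -natr1 natrM; lra.
  have M'E : M' = expR (L / 3) ^+ 2 * M.
    by rewrite -expRM_natl -expRD; congr expR; rewrite -[2%:R]/(2 : R); field.
  have SS : (2 * S).+1%:R * (2 * S).+1%:R <= 9 * expR (L / 3) ^+ 2.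
    have -> : 9 * expR (L / 3) ^+ 2 = (3 * expR (L / 3)) * (3 * expR (L / 3)).
      by ring.
    by rewrite ler_pM.
  apply: (@le_trans _ _ (9 * expR (L / 3) ^+ 2 * (32 * N%:R ^+ 2 / M'))).
    by rewrite ler_wpM2r // divr_ge0 ?mulr_ge0 ?exprn_ge0 ?expR_ge0.
  have e0 : expR (L / 3) != 0 by rewrite gt_eqF // expR_gt0.
  have M1 : M != 0 by rewrite gt_eqF.
  by rewrite M'E le_eqVlt; apply/orP; left; apply/eqP; field; rewrite e0 M1.
move=> f f0 /norP[/existsPn nE1 /existsPn nE2].
have f0E : (box_vec f)`_0 = box_val (f i) by rewrite -box_vecE.
rewrite f0E in f0 *.
(* As a_0 is nonzero, its divisors are at most N, so the bounded quantifiers in [E1] and [E2] miss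
   none of them. *)
have mN m : (m %| `|box_val (f i)|)%N -> (m < N.+1)%N.
  move=> /dvdn_leq; rewrite absz_gt0 => /(_ f0) mle.
  by rewrite ltnS; exact: leq_trans mle (box_valP _).
split=> [m ma mc|m x y xS yS y0 my ma mc].
  apply: ln_nat_le; first by rewrite mulr_ge0 // ltW.
  by have := nE1 (Ordinal (mN m ma));
    rewrite /= /root_mod ma coprimen1 mc !andbT.
have inS (x' : int) : ln `|x'|%:R <= L / 3 -> (`|x'| <= S)%N.
  move=> H; rewrite truncn_ge_nat ?expR_ge0 //.
  have [->|x'0] := posnP `|x'|%N; first exact: expR_ge0.
  by rewrite -[leLHS]lnK ?posrE ?ltr0n // ler_expR.
have [u uE] := box_val_surj (inS x xS); have [v vE] := box_val_surj (inS y yS).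
apply: ln_nat_le; first by rewrite mulr_ge0 // addr_ge0 // ltW.
have /existsPn/(_ (Ordinal (mN m ma))) := nE2 (u, v).
by rewrite /= /root_mod ma uE vE my mc !andbT.
Qed.

Lemma nongeneric_rare (R : realType) (d N : nat) (de : R) : (2 <= d)%N ->
  (0 < N)%N -> 0 < de -> de <= 1 ->
  exists E : pred {ffun 'I_d -> 'I_(2 * N).+1},
    #|E|%:R <= #|{: {ffun 'I_d -> 'I_(2 * N).+1}}|%:R
               * (440 / expR (de * ln N%:R)) :> R
    /\ forall f, (box_vec f)`_0 != 0 -> (box_vec f)`_(d.-1) != 0 -> ~~ E f ->
       generic N de (box_vec f).
Proof.
move=> d2 N0 de0 de1; set L := ln N%:R; set M := expR (de * L).
have L0 : 0 <= L by exact: ln_nat_ge0.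
have M0 : 0 < M by exact: expR_gt0.
have deL : 0 <= de * L by rewrite mulr_ge0 // ltW.
pose i : 'I_d := Ordinal (ltnW d2).
have dd : (d.-1 < d)%N by rewrite prednK // ltnW.
pose j : 'I_d := Ordinal dd.
have ij : i != j by rewrite -val_eqE /=; lia.
pose s := expR ((1 - de) * L).
have s1 : 1 <= s by rewrite -expR0 ler_expR mulr_ge0 // subr_ge0.
have sM : s = N%:R / M.
  by rewrite /s mulrBl mul1r expRB lnK // posrE ltr0n.
pose T := {ffun 'I_d -> 'I_(2 * N).+1}; pose K := 'I_(2 * N).+1.
pose small := [pred u : K * K | `|box_val u.1|%N%:R <= s].
pose sqd := [pred u : K * K | [exists m : 'I_N.+1,
      (M < m%:R) && ((box_val u.1 != 0) && (m ^ 2 %| `|box_val u.1|)%N)]].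
pose cmd := [pred u : K * K | [exists m : 'I_N.+1,
      (M < m%:R)
      && ((m %| `|box_val u.1|)%N && (m %| `|box_val u.2|)%N)]].
have [E0 [E0c E0P]] : exists E : pred T, #|E|%:R <= #|{: T}|%:R * (320 / M)
    /\ forall f, (box_vec f)`_0 != 0 -> ~~ E f -> (2 < d)%N ->
       (forall m : nat, (m %| `|((box_vec f)`_0)%R|)%N ->
          (m %| `|psi_cof (box_vec f) 1 1|)%N -> ln m%:R <= de * L)
       /\ (forall (m : nat) (x y : int),
          ln `|x|%:R <= L / 3 :> R -> ln `|y|%:R <= L / 3 :> R ->
          y != 0 -> coprime m `|y| -> (m %| `|((box_vec f)`_0)%R|)%N ->
          (m %| `|psi_cof (box_vec f) x y|)%N ->
          ln m%:R <= (2 / 3 + de) * L).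
  have [d3|d3] := ltnP 2 d.
    have [E [Ec EP]] := small_root_rare d3 N0 de0.
    by exists E; split=> // f f0 fE _; exact: EP.
  (* For d = 2 the conditions on Q are vacuous. *)
  exists pred0; rewrite card0; split=> //.
  by rewrite mulr_ge0 ?ler0n ?divr_ge0 ?ler0n ?(ltW M0).
have h12 : #|small|%:R <= N%:R ^+ 2 * (12 / M).
  have := box_small_rare N0 s1.
  rewrite -(card_fst (fun u : K => `|box_val u|%N%:R <= s)) => h.
  apply: le_trans h _; rewrite sM le_eqVlt; apply/orP; left; apply/eqP.
  by ring.
have hsq : #|sqd|%:R <= N%:R ^+ 2 * (32 / M).
  by rewrite mulrA [_ * 32]mulrC; exact: sqr_divisor_rare.
have hcm : #|cmd|%:R <= N%:R ^+ 2 * (32 / M).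
  by rewrite mulrA [_ * 32]mulrC; exact: common_divisor_rare.
have c12 : 0 <= 12 / M by rewrite divr_ge0 // ltW.
have c32 : 0 <= 32 / M by rewrite divr_ge0 // ltW.
have ji : j != i by rewrite eq_sym.
exists [predU E0 & [predU [predU [pred f : T | small (f i, f j)] &
    [pred f : T | small (f j, f i)]] &
  [predU [predU [pred f : T | sqd (f i, f j)] & [pred f : T | sqd (f j, f i)]] &
    [pred f : T | cmd (f i, f j)]]]]; split.
  (* The conditions on Q cost 320, the two size conditions 12 each, the two square divisor
     conditions and the gcd condition 32 each. *)
  have -> : 440 / M = 320 / M + (12 / M + 12 / M + (32 / M + 32 / M + 32 / M)).
    by ring.
  rewrite !mulrDr; apply: card_predU_le => //; apply: card_predU_le.
    by apply: card_predU_le; exact: rare_pair.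
  by apply: card_predU_le; [apply: card_predU_le|]; exact: rare_pair.
move=> f f0 fd; have fiE : (box_vec f)`_0 = box_val (f i) by rewrite -box_vecE.
have fjE : (box_vec f)`_(d.-1) = box_val (f j) by rewrite -box_vecE.
case/norP=> nE0 /norP[/norP[/= ns1 ns2] /norP[/norP[]]].
move=> /existsPn /= nq1 /existsPn /= nq2 /existsPn /= ncm.
have E0f := E0P f f0 nE0; rewrite fiE fjE in f0 fd.
have bound (u : K) m : box_val u != 0 -> (m %| `|box_val u|)%N -> (m < N.+1)%N.
  move=> u0 /dvdn_leq; rewrite absz_gt0 => /(_ u0) mle.
  by rewrite ltnS; exact: leq_trans mle (box_valP _).
have large (u : K) : ~~ (`|box_val u|%N%:R <= s) ->
    (1 - de) * L <= ln `|box_val u|%:R.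
  rewrite -ltNge => /ltW h; rewrite -[leLHS]expRK ler_ln ?posrE ?expR_gt0 //.
  by apply: lt_le_trans h; exact: expR_gt0.
have sqfree (u : K) m : box_val u != 0 -> (forall m' : 'I_N.+1,
    ~~ ((M < m'%:R) && ((box_val u != 0) && (m' ^ 2 %| `|box_val u|)%N))) ->
    (m ^ 2 %| `|box_val u|)%N -> ln m%:R <= de * L.
  move=> u0 H mu; have mN : (m < N.+1)%N.
    by apply: bound u0 _; apply: dvdn_trans mu; rewrite expnS dvdn_mulr.
  by apply: ln_nat_le => //; have := H (Ordinal mN); rewrite u0 mu !andbT.
split; rewrite ?fiE ?fjE.
- rewrite /coef_height; apply/bigmax_leqP_seq => x /tnthP[k ->] _.
  by rewrite tnth_mktuple box_valP.
- split; [exact: large | exact: large |].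
  set g := gcdn _ _; have gN : (g < N.+1)%N by apply: (bound (f i)) => //;
    exact: dvdn_gcdl.
  apply: ln_nat_le => //; have := ncm (Ordinal gN).
  by rewrite /= dvdn_gcdl dvdn_gcdr !andbT.
- by split=> m; [exact: sqfree | exact: sqfree].
- by move=> d3 m; have [h _] := E0f d3; rewrite fiE in h; exact: h.
- by move=> d3 m x y; have [_ h] := E0f d3; rewrite fiE in h; exact: h.
Qed.

(** * Counting polynomials *)

Lemma dvdn_big_gcdn (s : seq int) (m n : nat) :
  (forall x, x \in s -> (m %| `|x| * n)%N) ->
  (m %| (\big[gcdn/0%N]_(x <- s) `|x|%N) * n)%N.
Proof.
elim: s => [|x s IHs] H; first by rewrite big_nil.
rewrite big_cons muln_gcdl dvdn_gcd H ?mem_head // IHs // => y ys.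
by rewrite H // inE ys orbT.
Qed.

Lemma big_gcdn_dvd (s : seq int) (c : int) :
  c \in s -> (\big[gcdn/0%N]_(x <- s) `|x|%N %| `|c|)%N.
Proof.
elim: s => // y s IHs; rewrite inE big_cons => /orP[/eqP->|/IHs].
  exact: dvdn_gcdl.
by apply: dvdn_trans; exact: dvdn_gcdr.
Qed.

(** The jump of the index reflects the missing degree d - 1: the last entry is the coefficient of
    degree d. *)
Lemma psi_coef (d : nat) (a : d.-tuple int) (k : nat) : (2 <= d)%N ->
  (0 < k < d)%N ->
  (a`_k)%:~R / (a`_0)%:~R = (psi a)`_(if k == d.-1 then d else k).
Proof.
move=> d2 /andP[k0 kd]; have d0 : (d == 0)%N = false by case: (d) d2.
rewrite /psi !coefD coefZ coefXn coef1 coef_sum.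
have [kE|kd1] := eqVneq k d.-1.
  rewrite eqxx mulr1 d0 addr0 big_nat big1 ?addr0 -?kE // => i /andP[i1 i2].
  by rewrite coefZ coefXn; case: eqP => [?|_]; [lia | rewrite mulr0].
have -> : (k == d) = false by rewrite ltn_eqF.
have -> : (k == 0)%N = false by case: (k) k0.
rewrite mulr0 add0r addr0 (bigD1_seq k) ?iota_uniq //=; last first.
  by rewrite mem_index_iota k0 /=; lia.
rewrite coefZ coefXn eqxx mulr1 big1 ?addr0 // => i ik.
by rewrite coefZ coefXn eq_sym (negbTE ik) mulr0.
Qed.

(** Equal coefficients give a_k b_0 = b_k a_0, so a_0 divides every a_k b_0, hence their gcd, which
    is b_0 up to sign by primitivity. *)
Lemma psi_dvd (d : nat) (a b : d.-tuple int) : (2 <= d)%N ->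
  primitive a -> a`_0 != 0 -> b`_0 != 0 -> psi a = psi b ->
  (`|(a`_0)%R| %| `|(b`_0)%R|)%N.
Proof.
move=> d2 pa a0 b0 ab.
have : (`|(a`_0)%R| %| (\big[gcdn/0%N]_(x <- a) `|x|%N) * `|(b`_0)%R|)%N.
  apply: dvdn_big_gcdn => x /tnthP[i ->]; rewrite (tnth_nth 0).
  have [->|i0] := posnP i; first by rewrite dvdn_mulr.
  have id : (0 < i < d)%N by rewrite i0 ltn_ord.
  have := psi_coef a d2 id; rewrite ab -psi_coef // => /eqP.
  rewrite eqr_div ?intr_eq0 // -!intrM eqr_int => /eqP E.
  by rewrite -abszM E abszM dvdn_mull.
by rewrite pa mul1n.
Qed.

(** Two positive integers dividing each other are equal, so the constant entries agree and then all
    others. Polynomials can therefore be counted through their vectors. *)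
Lemma psi_inj (d : nat) (a b : d.-tuple int) : (2 <= d)%N ->
  admissible a -> admissible b -> psi a = psi b -> a = b.
Proof.
move=> d2 [pa _ a0] [pb _ b0] ab.
have a0n : a`_0 != 0 by rewrite gt_eqF.
have b0n : b`_0 != 0 by rewrite gt_eqF.
have ab0 : a`_0 = b`_0.
  have h1 := psi_dvd d2 pa a0n b0n ab.
  have h2 := psi_dvd d2 pb b0n a0n (esym ab).
  have : `|(a`_0)%R|%N = `|(b`_0)%R|%N by apply/eqP; rewrite eqn_dvd h1 h2.
  by move: a0 b0; lia.
apply: eq_from_tnth => i; rewrite !(tnth_nth 0).
have [->|i0] := posnP i; first exact: ab0.
have id : (0 < i < d)%N by rewrite i0 ltn_ord.
have := psi_coef a d2 id; rewrite ab -psi_coef // ab0 => H.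
by apply/(intr_inj (R := rat))/(mulIf _ H); rewrite invr_eq0 intr_eq0.
Qed.

Lemma mem_fset_set (T : choiceType) (A : set T) (x : T) : finite_set A ->
  (x \in finmap.enum_fset (fset_set A)) = (x \in A).
Proof. by move=> fA; exact: in_fset_set. Qed.

Lemma cardinal_le_size (T : choiceType) (A : set T) (s : seq T) :
  finite_set A -> (forall x, A x -> x \in s) -> (cardinal A <= size s)%N.
Proof.
move=> fA As; apply: uniq_leq_size; first exact: finmap.fset_uniq.
by move=> x; rewrite mem_fset_set // inE => /As.
Qed.

Lemma size_le_cardinal (T : choiceType) (A : set T) (s : seq T) :
  finite_set A -> uniq s -> (forall x, x \in s -> A x) ->
  (size s <= cardinal A)%N.
Proof.
move=> fA us sA; apply: uniq_leq_size => // x /sA Ax.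
by rewrite mem_fset_set // inE.
Qed.

Lemma mem_cardinal (T : choiceType) (A : set T) : finite_set A ->
  exists2 s : seq T, size s = cardinal A & forall x, A x -> x \in s.
Proof.
move=> fA; exists (finmap.enum_fset (fset_set A)) => // x Ax.
by rewrite mem_fset_set // inE.
Qed.

Lemma box_vec_surj (d N : nat) (a : d.-tuple int) : (coef_height a <= N)%N ->
  exists f : {ffun 'I_d -> 'I_(2 * N).+1}, box_vec f = a.
Proof.
move=> aN; exists [ffun i : 'I_d => inord `|(a`_i + N%:Z)%R|].
apply: eq_from_tnth => i; rewrite tnth_mktuple ffunE (tnth_nth 0) /box_val.
have := leq_trans (coef_height_ge a (ltn_ord i)) aN; set c := a`_i => h.
have lt : (`|(c + N%:Z)%R| < (2 * N).+1)%N by lia.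
by rewrite inordK //; lia.
Qed.

Lemma box_vec_inj (d N : nat) :
  injective (@box_vec d N).
Proof.
move=> f g fg; apply/ffunP => i; apply: val_inj.
have := box_vecE f i; rewrite fg box_vecE /box_val.
by move=> /addIr[/esym].
Qed.

Lemma box_vec_height (d N : nat) (f : {ffun 'I_d -> 'I_(2 * N).+1}) :
  (coef_height (box_vec f) <= N)%N.
Proof.
rewrite /coef_height; apply/bigmax_leqP_seq => x /tnthP[k ->] _.
by rewrite tnth_mktuple box_valP.
Qed.

(** * A positive proportion of admissible vectors *)

Lemma card_multiples (N m : nat) : (0 < m)%N ->
  (#|[pred u : 'I_N | (m %| u.+1)%N]| <= N %/ m)%N.
Proof.
move=> m0; set P := [pred u | _].
have [u0 Pu0|P0] := pickP P; last by rewrite eq_card0.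
have Nm : (0 < N %/ m)%N by rewrite divn_gt0 // (leq_trans (dvdn_leq _ Pu0)).
rewrite -(prednK Nm) -[leqRHS]card_ord.
rewrite -(card_in_image (f := fun u : 'I_N =>
  inord (u.+1 %/ m).-1 : 'I_(N %/ m).-1.+1) (A := P)); first exact: max_card.
have bnd (u : 'I_N) : (m %| u.+1)%N -> (0 < u.+1 %/ m <= N %/ m)%N.
  by move=> mu; rewrite divn_gt0 // (dvdn_leq _ mu) //= leq_div2r.
move=> u v; rewrite !inE => mu mv /(congr1 val) /=.
have /andP[u1 u2] := bnd u mu; have /andP[v1 v2] := bnd v mv.
rewrite !inordK ?prednK // => E.
apply: val_inj; apply: succn_inj => /=.
by rewrite -(divnK mu) -(divnK mv); congr (_ * _)%N; lia.
Qed.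

(* The constant is 1 - 3/4, where 3/4 bounds the sum of 1/m^2 over m >= 2. *)
Lemma card_coprime_ge (R : realType) (N : nat) :
  N%:R ^+ 2 / 4
  <= #|[pred u : 'I_N * 'I_N | coprime u.1.+1 u.2.+1]|%:R :> R.
Proof.
set C := [pred u | _].
have N2 : #|{: 'I_N * 'I_N}|%:R = N%:R ^+ 2 :> R.
  by rewrite card_prod card_ord natrM expr2.
have CC : #|C|%:R + #|[predC C]|%:R = N%:R ^+ 2 :> R.
  by rewrite -N2 -natrD cardC.
suff : #|[predC C]|%:R <= N%:R ^+ 2 * (3 / 4) :> R by lra.
(* The sum runs over 2 <= m <= n + 2. Equality holds at n = 0, and the induction telescopes with
   1/(k + 1)^2 <= 1/k - 1/(k + 1). *)
have tail n : \sum_(0 <= m < n.+3 | (1 < m)%N) (m%:R ^+ 2)^-1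
    <= 3 / 4 - n.+2%:R^-1 :> R.
  elim: n => [|n IHn].
    rewrite !big_mkcond !big_nat_recr //= big_geq //= -[2%:R]/(2 : R).
    by lra.
  rewrite big_mkcond big_nat_recr //= -big_mkcond /=.
  apply: le_trans (lerD IHn (lexx _)) _.
  have n0 : 0 < n.+2%:R :> R by rewrite ltr0n.
  rewrite -[n.+3%:R]natr1; set k := n.+2%:R in n0 *.
  have -> : 3 / 4 - (k + 1)^-1 = 3 / 4 - k^-1 + (k * (k + 1))^-1.
    by field; apply/andP; split; lra.
  by rewrite lerD2l lef_pV2 ?posrE ?mulr_gt0 ?exprn_gt0 //; nra.
have tailN : \sum_(m < N.+1 | (1 < m)%N) (m%:R ^+ 2)^-1 <= 3 / 4 :> R.
  rewrite -(big_mkord (fun m => 1 < m)%N (fun m => (m%:R ^+ 2)^-1)).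
  apply: (@le_trans _ _ (\sum_(0 <= m < N.+3 | (1 < m)%N) (m%:R ^+ 2)^-1)).
    rewrite [leRHS](big_cat_nat (n := N.+1)) //=; last by rewrite ltnS ltnW.
    by rewrite lerDl sumr_ge0 // => m _; rewrite invr_ge0 exprn_ge0.
  by apply: le_trans (tail N) _; rewrite gerBl invr_ge0.
pose Pm (m : nat) := [pred u : 'I_N * 'I_N | (m %| u.1.+1)%N && (m %| u.2.+1)%N].
apply: (@le_trans _ _ (\sum_(m < N.+1 | (1 < m)%N) #|Pm m|%:R)).
  rewrite -natr_sum ler_nat.
  apply: leq_trans (card_exists_le (fun m : 'I_N.+1 => 1 < m)%N
    (fun m : 'I_N.+1 => Pm m)).
  apply/subset_leq_card/fintype.subsetP => -[u v] /=; rewrite !inE /= => ncp.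
  have g0 : (0 < gcdn u.+1 v.+1)%N by rewrite gcdn_gt0.
  have gN : (gcdn u.+1 v.+1 < N.+1)%N.
    by rewrite ltnS (leq_trans (dvdn_leq _ (dvdn_gcdl _ _))).
  apply/existsP; exists (Ordinal gN); rewrite /= dvdn_gcdl dvdn_gcdr !andbT.
  by rewrite ltn_neqAle g0 andbT eq_sym.
apply: (@le_trans _ _ (\sum_(m < N.+1 | (1 < m)%N)
    N%:R ^+ 2 * (m%:R ^+ 2)^-1)); last first.
  by rewrite -mulr_sumr ler_wpM2l // exprn_ge0.
apply: ler_sum => m m1; have m0 : (0 < m)%N by exact: ltnW.
have -> : #|Pm m| = (#|[pred u : 'I_N | (m %| u.+1)%N]|
    * #|[pred u : 'I_N | (m %| u.+1)%N]|)%N.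
  by rewrite -cardX; apply: eq_card => -[u v]; rewrite !inE.
have h : #|[pred u : 'I_N | (m %| u.+1)%N]|%:R <= N%:R / m%:R :> R.
  rewrite ler_pdivlMr ?ltr0n // -natrM ler_nat.
  by apply: leq_trans (leq_trunc_div N m);
    rewrite leq_mul2r card_multiples ?orbT.
by rewrite natrM -exprVn -exprMn expr2 ler_pM.
Qed.

(** It suffices that a_0 > 0 and a_d be nonzero and coprime. At least N^2/4 of the (2N + 1)^2 <= 9
    N^2 pairs qualify, whence 36. *)
Lemma card_admissible_ge (R : realType) (d N : nat) : (2 <= d)%N ->
  (0 < N)%N ->
  exists G : pred {ffun 'I_d -> 'I_(2 * N).+1},
    #|{: {ffun 'I_d -> 'I_(2 * N).+1}}|%:R <= 36 * #|G|%:R :> R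
    /\ forall f, G f -> admissible (box_vec f).
Proof.
move=> d2 N0; pose i : 'I_d := Ordinal (ltnW d2).
have dd : (d.-1 < d)%N by rewrite prednK // ltnW.
pose j : 'I_d := Ordinal dd.
have ij : i != j by rewrite -val_eqE /=; lia.
pose K := 'I_(2 * N).+1.
pose C := [pred u : 'I_N * 'I_N | coprime u.1.+1 u.2.+1].
pose Q := [pred u : K * K | [&& 0 < box_val u.1, box_val u.2 != 0
  & coprime `|box_val u.1| `|box_val u.2|]].
have CQ : (#|C| <= #|Q|)%N.
  have lt (u : 'I_N) : (u.+1 + N < (2 * N).+1)%N by have := ltn_ord u; lia.
  pose s (u : 'I_N * 'I_N) : K * K := (Ordinal (lt u.1), Ordinal (lt u.2)).
  have sI : injective s.
    move=> [u1 u2] [v1 v2] [/addIn e1 /addIn e2].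
    by congr (_, _); apply: val_inj => /=; lia.
  rewrite -(card_imset (mem C) sI); apply/subset_leq_card/fintype.subsetP.
  move=> _ /imsetP[u Cu ->]; rewrite !inE /= /box_val /= in Cu *.
  have e (n : nat) : (n.+1 + N)%:Z - N%:Z = n.+1%:Z by lia.
  by rewrite !e.
pose G := [pred f : {ffun 'I_d -> K} | Q (f i, f j)].
exists G; split; last first.
  move=> f /and3P[/= a0 ad cop]; split.
  - apply/eqP; rewrite -dvdn1 -(eqP cop) dvdn_gcd -!box_vecE.
    have dvd k : (k < d)%N ->
        (\big[gcdn/0%N]_(x <- box_vec f) `|x|%N %| `|((box_vec f)`_k)%R|)%N.
      by move=> kd; apply: big_gcdn_dvd; rewrite mem_nth ?size_tuple.
    by rewrite !dvd.
  - by rewrite (box_vecE f j).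
  - by rewrite (box_vecE f i).
have K0 : 0 < ((2 * N).+1 ^ 2)%:R :> R by rewrite ltr0n expn_gt0.
have K9 : ((2 * N).+1 ^ 2)%:R <= 9 * N%:R ^+ 2 :> R.
  by rewrite -natrX -natrM ler_nat !expnS !expn0; nia.
have main : #|{: {ffun 'I_d -> K}}|%:R * (N%:R ^+ 2 / 4)
    <= ((2 * N).+1 ^ 2)%:R * #|G|%:R :> R.
  rewrite -[leRHS]natrM (card_fibers2 G ij) natr_sum.
  rewrite mulr_natl -sumr_const; apply: ler_sum => f _.
  apply: le_trans (card_coprime_ge R N) _; rewrite ler_nat.
  apply: leq_trans CQ _; apply/eq_leq/eq_card => -[u v].
  have ji : (j == i) = false by rewrite eq_sym; exact: negbTE.
  by rewrite !inE /= /upd2 !ffunE !eqxx ji.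
have N20 : 0 < N%:R ^+ 2 :> R by rewrite exprn_gt0 ?ltr0n.
have : #|{: {ffun 'I_d -> K}}|%:R * (N%:R ^+ 2 / 4)
    <= 9 * N%:R ^+ 2 * #|G|%:R :> R.
  by apply: le_trans main _; rewrite ler_wpM2r.
move=> h; rewrite -(ler_pM2l N20); lra.
Qed.

(** The polynomials violating the estimate come from the exceptional set, of proportion at most
    440/N^de in the box, while all polynomials counted make up at least 1/36 of it. *)
Lemma generic_ratio (R : realType) (d : nat) (X eps de : R) :
  (2 <= d)%N -> 1 <= X -> 0 < de -> de <= 2^-1 -> 12 * de <= eps ->
  6 * de < (d%:R * (d%:R - 1))^-1 ->
  0 < ln (Num.trunc X)%:R :> R ->
  ln (2 * d%:R) <= de * ln (Num.trunc X)%:R ->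
  `| 1 - (cardinal (Pd d X))%:R^-1 *
     (cardinal (Pd_such_that X (fun a : d.-tuple int =>
        `| lambda1 R d (psi a)
           - ln (coef_height a)%:R / (d%:R * (d%:R - 1)) |
        <= eps * ln (coef_height a)%:R)))%:R |
  <= 36 * 440 / expR (de * ln (Num.trunc X)%:R) :> R.
Proof.
move=> d2 X1 de0 de2 de12 deK; set N := Num.trunc X => L0 dN.
set Q := fun a : d.-tuple int => _; set A := Pd d X; set B := Pd_such_that X Q.
have N0 : (0 < N)%N by rewrite truncn_gt0.
have X0 : 0 <= X by apply: le_trans X1.
have hN (a : d.-tuple int) : ((coef_height a)%:R <= X) = (coef_height a <= N)%N.
  by rewrite truncn_ge_nat.
pose T := {ffun 'I_d -> 'I_(2 * N).+1}; pose g (f : T) := psi (box_vec f).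
have BA : B `<=` A by move=> _ [a [? ? _] <-]; exists a.
have fA : finite_set A.
  apply: (@sub_finite_set _ _ [set g f | f in [set: T]]); last first.
    exact: finite_image finite_finset.
  move=> _ [a [_ aX] <-]; rewrite hN in aX.
  have [f fE] := box_vec_surj aX.
  by exists f => //; rewrite /g fE.
have fB : finite_set B by exact: sub_finite_set BA fA.
have cBA : (cardinal B <= cardinal A)%N.
  have [s <- sA] := mem_cardinal fA.
  by apply: cardinal_le_size => // x /BA /sA.
have [G [Gc GP]] := card_admissible_ge R d2 N0.
have GA : (#|G| <= cardinal A)%N.
  rewrite cardE -(size_map g); apply: size_le_cardinal => //.
    rewrite map_inj_in_uniq ?enum_uniq // => f1 f2.
    rewrite !mem_enum => /GP a1 /GP a2 /(psi_inj d2 a1 a2).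
    exact: box_vec_inj.
  move=> _ /mapP[f fG ->]; rewrite mem_enum in fG; exists (box_vec f) => //.
  by split; [exact: GP | rewrite hN box_vec_height].
have de1 : de <= 1 by lra.
have [E [Ec EP]] := @nongeneric_rare R d N de d2 N0 de0 de1.
have AB : (cardinal A <= cardinal B + #|E|)%N.
  have [s <- sB] := mem_cardinal fB.
  rewrite [#|E|]cardE -(size_map g) -size_cat; apply: cardinal_le_size => // x.
  move=> [a [adm aN] <-]; rewrite hN in aN; rewrite mem_cat.
  have [f fE] := box_vec_surj aN; have [pa ad a0] := adm.
  have [fe|fe] := boolP (E f).
    apply/orP; right; apply/mapP; exists f; first by rewrite mem_enum.
    by rewrite /g fE.
  apply/orP; left; apply: sB; exists a => //; split=> //; first by rewrite hN.
  have a00 : a`_0 != 0 by rewrite gt_eqF.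
  apply: (generic_lambda1 d2 a00 ad de0 de2 de12 deK L0 dN).
  by rewrite -fE in a00 ad *; exact: EP.
set M := expR _; have M0 : 0 < M by exact: expR_gt0.
set cT := #|{: T}|%:R in Gc Ec.
have T0 : 0 < cT :> R.
  by rewrite ltr0n card_ffun !card_ord expn_gt0.
have cA0 : 0 < (cardinal A)%:R :> R.
  have : #|G|%:R <= (cardinal A)%:R :> R by rewrite ler_nat.
  by lra.
have h1 : (cardinal A)%:R <= (cardinal B)%:R + #|E|%:R :> R.
  by rewrite -natrD ler_nat.
have h2 : (cardinal B)%:R <= (cardinal A)%:R :> R by rewrite ler_nat.
have -> : 1 - (cardinal A)%:R^-1 * (cardinal B)%:R
    = ((cardinal A)%:R - (cardinal B)%:R) / (cardinal A)%:R :> R.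
  by field; rewrite gt_eqF.
rewrite ger0_norm; last by rewrite divr_ge0 ?subr_ge0.
rewrite ler_pdivrMr //; apply: (@le_trans _ _ #|E|%:R); first by lra.
apply: le_trans Ec _; rewrite mulrC.
have c0 : 0 <= 440 / M by rewrite divr_ge0 ?ler0n ?(ltW M0).
have -> : 36 * 440 / M * (cardinal A)%:R = 440 / M * (36 * (cardinal A)%:R).
  by rewrite [RHS]mulrCA !mulrA.
rewrite ler_wpM2l //; apply: le_trans Gc _.
by rewrite ler_wpM2l ?ler0n // ler_nat.
Qed.

Theorem theorem1p2 (R : realType) (d : nat) (eps : R)
    (hd : (2 <= d)%N) (heps : 0 < eps) :
  (fun X : R =>
     ((cardinal (Pd d X))%:R)^-1 *
     (cardinal (Pd_such_that X (fun a : d.-tuple int =>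
        `| lambda1 R d (psi a)
           - ln (coef_height a)%:R / (d%:R * (d%:R - 1)) |
        <= eps * ln (coef_height a)%:R)))%:R : R) @ +oo --> (1 : R).
Proof.
have d2r : 2 <= d%:R :> R by rewrite ler_nat.
have dd : 2 <= d%:R * (d%:R - 1) :> R by nra.
have K0 : 0 < (d%:R * (d%:R - 1))^-1 :> R by rewrite invr_gt0; lra.
have K1 : (d%:R * (d%:R - 1))^-1 <= 2^-1 :> R by rewrite lef_pV2 ?posrE //; lra.
have [de [de0 de1 de2]] : exists de : R,
    [/\ 0 < de, 12 * de <= eps & 12 * de <= (d%:R * (d%:R - 1))^-1].
  (* The bound 12 [de] <= 1/(d(d - 1)) also yields the strict inequality for 6 [de]. *)
  exists (Num.min (eps / 12) ((d%:R * (d%:R - 1))^-1 / 12)).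
  rewrite lt_min !divr_gt0 // -!ler_pdivlMl // ![12^-1 * _]mulrC !ge_min !lexx.
  by rewrite orbT.
have deh : de <= 2^-1 by lra.
have deK : 6 * de < (d%:R * (d%:R - 1))^-1 by lra.
have ratio X X1 := @generic_ratio R d X eps de hd X1 de0 deh de1 deK.
apply/cvgrPdist_le => e e0.
move: ratio; move: (36 * 440) => C ratio.
have [L [L1 Ld Le]] : exists L : R,
    [/\ 1 <= L, ln (2 * d%:R) <= L * de & C / e <= L * de].
  exists (Num.max 1 (Num.max (ln (2 * d%:R) / de) (C / e / de))).
  by rewrite -!ler_pdivrMr // !le_max !lexx !orbT.
(* The extra 1 pays for truncating X. *)
exists (expR L + 1); split; first exact: num_real.
move=> X XL; have eL := expR_gt0 L.
have X1 : 1 <= X by lra.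
have LN : L <= ln (Num.trunc X)%:R.
  have := truncnS_gt X; rewrite -natr1 => h.
  by rewrite -[leLHS]expRK ler_ln ?posrE //; lra.
have LdN : L * de <= de * ln (Num.trunc X)%:R by rewrite mulrC ler_wpM2l // ltW.
have N0 : 0 < ln (Num.trunc X)%:R :> R by apply: lt_le_trans LN; lra.
apply: le_trans (ratio X X1 N0 (le_trans Ld LdN)) _.
(* The crude bound exp(t) >= 1 + t is enough, since t = de log N is at least C/e. *)
rewrite ler_pdivrMr ?expR_gt0 // mulrC -ler_pdivrMr //.
apply: le_trans (le_trans Le LdN) _; apply: le_trans (expR_ge1Dx _).
by rewrite lerDr.
Qed.
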